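(* Let $a$ be a prime number and let $b>3a$ be an integer not divisible by $a$. Write $b=na+r$ with $1\leq r\leq a-1$. Let $H$ be a Weierstrass semigroup containing $\langle a;b\rangle$, having no element outside of $\langle a;b\rangle$ smaller than $(n+1)a$, and having genus $g>\frac{(a-1)(b-a+r)}{2}$. Then $H$ occurs at most once.
   Context: Curves are smooth, irreducible, projective, over $\mathbb{C}$. $\langle a;b\rangle$ denotes the subsemigroup of $\mathbb{N}=\{0,1,2,\dots\}$ generated by $a$ and $b$. A subsemigroup $H\subseteq\mathbb{N}$ is called a Weierstrass semigroup of genus $g$ if $\mathbb{N}\setminus H$ has exactly $g$ elements. For a point $P$ on a smooth curve $C$, $\mathrm{WS}(P)=\{0\}\cup\{m\in\mathbb{N}: |mP| \text{ is base point free}\}$. A Weierstrass semigroup $H$ of genus $g$ occurs at most once if there is no curve of genus $g$ having two different points $P\neq Q$ with $\mathrm{WS}(P)=\mathrm{WS}(Q)=H$. *)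

(* Defs.v *)
From HB Require Import structures.
From mathcomp Require Import all_boot all_order all_algebra.
From mathcomp Require Import generic_quotient ring_quotient fraction.
From mathcomp Require Import complex reals.
From mathcomp Require Import boolp classical_sets functions cardinality.
From mathcomp Require Import freeg mpoly.

Set Implicit Arguments.
Unset Strict Implicit.
Unset Printing Implicit Defensive.

Import GRing.Theory Num.Theory.

Local Open Scope ring_scope.
Local Open Scope quotient_scope.
Local Open Scope classical_set_scope.

(* The library gives {ideal_quot I} only a commutative ring structure; the
   following equips it with the (classical) inverse and, I being prime, makes it
   an integral domain, so that it has a field of fractions. *)
Section QuotientDomain.
Variables (S : comNzRingType) (I : prime_idealr S).

Definition quot_domain : Type := {ideal_quot I}.

HB.instance Definition _ := GRing.ComNzRing.on quot_domain.

Definition quot_unit (x : quot_domain) : bool := `[< exists y, y * x = 1 >].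

Definition quot_inv (x : quot_domain) : quot_domain :=
  if pselect (exists y, y * x = 1) is left ex then projT1 (cid ex) else x.

Fact quot_mulVr : {in quot_unit, left_inverse 1 quot_inv *%R}.
Proof.
move=> x /asboolP ux; rewrite /quot_inv; case: pselect => // ex.
by case: cid.
Qed.

Fact quot_unitP (x y : quot_domain) : y * x = 1 -> quot_unit x.
Proof. by move=> yx; apply/asboolP; exists y. Qed.

Fact quot_inv_out : {in [predC quot_unit], quot_inv =1 id}.
Proof.
move=> x /asboolP ux; rewrite /quot_inv.
by case: pselect.
Qed.

HB.instance Definition _ := GRing.ComNzRing_hasMulInverse.Build quot_domain
  quot_mulVr quot_unitP quot_inv_out.

Fact quot_integral : GRing.integral_domain_axiom quot_domain.
Proof. by move=> x y; apply: Quotient.rquot_IdomainAxiom. Qed.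

HB.instance Definition _ :=
  GRing.ComUnitRing_isIntegral.Build quot_domain quot_integral.

Definition quot_proj (F : S) : quot_domain := \pi_({ideal_quot I}) F.

End QuotientDomain.

Section Varieties.
Variables (k : closedFieldType) (n : nat).

Definition homogeneous_ideal (I : {pred {mpoly k[n.+1]}}) : Prop :=
  forall (F : {mpoly k[n.+1]}) (d : nat),
    F \in I -> pihomog mdeg d F \in I.

(* Points of P^n are represented by their unique homogeneous coordinate vector
   whose first nonzero entry is 1, so that equality of points is Leibniz
   equality. *)
Definition normalized (v : 'rV[k]_n.+1) : bool :=
  [exists i, (v 0 i == 1) && [forall j : 'I_n.+1, (j < i)%N ==> (v 0 j == 0)]].

Definition eval_at (v : 'rV[k]_n.+1) (F : {mpoly k[n.+1]}) : k :=
  F.@[fun i => v 0 i].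

(* X = Proj (k[X_0, ..., X_n] / I) is the closed subvariety of P^n defined by
   the homogeneous prime ideal I. *)
Variable I : prime_idealr {mpoly k[n.+1]}.

Definition on_variety (v : 'rV[k]_n.+1) : bool :=
  normalized v && `[< forall F : {mpoly k[n.+1]}, F \in I -> eval_at v F = 0 >].

Definition ratio_field := {fraction (quot_domain I)}.

Definition frac_of (F G : {mpoly k[n.+1]}) : ratio_field :=
  tofrac (quot_proj I F) / tofrac (quot_proj I G).

Definition const_ratio (c : k) : ratio_field := tofrac (quot_proj I c%:MP).

(* k(X): quotients of forms of the same degree. *)
Definition function_field : set ratio_field :=
  [set f | exists (d : nat) (F G : {mpoly k[n.+1]}),
     [/\ F \is d.-homog, G \is d.-homog, G \notin I & f = frac_of F G]].

Definition local_ring (v : 'rV[k]_n.+1) : set ratio_field :=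
  [set f | exists (d : nat) (F G : {mpoly k[n.+1]}),
     [/\ F \is d.-homog, G \is d.-homog, eval_at v G != 0 & f = frac_of F G]].

Definition local_maximal_ideal (v : 'rV[k]_n.+1) : set ratio_field :=
  [set f | exists (d : nat) (F G : {mpoly k[n.+1]}),
     [/\ F \is d.-homog, G \is d.-homog, eval_at v G != 0,
         eval_at v F = 0 & f = frac_of F G]].

Definition alg_independent (d : nat) (f : 'I_d -> ratio_field) : Prop :=
  forall p : {mpoly k[d]}, mmap const_ratio f p = 0 -> p = 0.

(* dim X is the transcendence degree of k(X) over k. *)
Definition variety_dim (d : nat) : Prop :=
  (exists f : 'I_d -> ratio_field,
     (forall i, function_field (f i)) /\ alg_independent f) /\
  ~ (exists f : 'I_d.+1 -> ratio_field,
     (forall i, function_field (f i)) /\ alg_independent f).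

(* Jacobian criterion at a point v of X, for dim X = d: the rank never exceeds
   n - d on X, so it is enough that finitely many elements of I reach it. *)
Definition smooth_at (d : nat) (v : 'rV[k]_n.+1) : Prop :=
  exists (m : nat) (F : 'I_m -> {mpoly k[n.+1]}),
    (forall i, F i \in I) /\
    \rank (\matrix_(i < m, j < n.+1) eval_at v (F i)^`M(j)) = (n - d)%N.

(* h = dim_k (k[X_0, ..., X_n] / I)_m, witnessed by the basis e. *)
Definition hilbert_value (m h : nat) : Prop :=
  exists e : 'I_h -> {mpoly k[n.+1]},
    [/\ forall i, e i \is m.-homog,
        forall c : 'I_h -> k, \sum_i c i *: e i \in I -> forall i, c i = 0
      & forall F : {mpoly k[n.+1]}, F \is m.-homog ->
          exists c : 'I_h -> k, F - \sum_i c i *: e i \in I].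

End Varieties.

(* A smooth irreducible projective curve embedded in P^n; irreducibility is the
   primality of its ideal. *)
Record smooth_curve (k : closedFieldType) (n : nat) := SmoothCurve {
  curve_ideal : prime_idealr {mpoly k[n.+1]};
  curve_homogeneous : homogeneous_ideal curve_ideal;
  curve_dim1 : variety_dim curve_ideal 1;
  curve_smooth : forall v, on_variety curve_ideal v -> smooth_at curve_ideal 1 v
}.

Section Curves.
Variables (k : closedFieldType) (n : nat) (X : smooth_curve k n).

Local Notation I := (curve_ideal X).

Record point := Point {
  point_coord :> 'rV[k]_n.+1;
  point_on_curve : on_variety I point_coord
}.

HB.instance Definition _ := [isSub for point_coord].
HB.instance Definition _ := [Choice of point by <:].

(* The genus is read off the Hilbert polynomial d m + 1 - g of X, where d is the
   degree of X: it is the arithmetic genus 1 - P_X(0), which for a smooth curve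
   is the genus. *)
Definition has_genus (g : nat) : Prop :=
  exists d m0 : nat, forall m, (m0 <= m)%N ->
    exists2 h, hilbert_value I m h & (h + g = d * m + 1)%N.

(* At a smooth point the local ring is a discrete valuation ring, with valuation
   has_order; a uniformizer generates its maximal ideal. *)
Definition uniformizer (Q : point) (t : ratio_field I) : Prop :=
  local_maximal_ideal Q t /\
  forall f, local_maximal_ideal Q f ->
    exists2 h, local_ring Q h & f = h * t.

Definition has_order (Q : point) (f : ratio_field I) (j : int) : Prop :=
  exists t u : ratio_field I,
    [/\ uniformizer Q t, local_ring Q u, ~ local_maximal_ideal Q u
      & f = u * t ^ j].

Definition divisor := {freeg point / int}.

Definition is_div_of (f : ratio_field I) (D : divisor) : Prop :=
  forall Q : point, has_order Q f (coeff Q D).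

Definition effective (D : divisor) : Prop := forall Q, 0 <= coeff Q D.

Definition lin_equiv (D E : divisor) : Prop :=
  exists f : ratio_field I,
    [/\ function_field f, f != 0 & is_div_of f (D - E)].

Definition complete_linear_system (E : divisor) : set divisor :=
  [set D | effective D /\ lin_equiv D E].

Definition base_point_free (L : set divisor) : Prop :=
  forall Q : point, exists2 D, L D & coeff Q D = 0.

Definition WS (P : point) : set nat :=
  [set 0%N] `|`
  [set m | base_point_free (complete_linear_system << m%:Z *g P >>)].

End Curves.

Definition subsemigroup (H : set nat) : Prop :=
  H 0%N /\ forall x y, H x -> H y -> H (x + y)%N.

Definition semigroup_gen (a b : nat) : set nat :=
  smallest subsemigroup [set a; b].

Definition weierstrass_semigroup (g : nat) (H : set nat) : Prop :=
  subsemigroup H /\ (~` H #= `I_g)%card.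

(* R[i], for R a model of the real numbers, is the field of complex numbers; n is
   the dimension of the ambient projective space. *)
Definition occurs_at_most_once (R : realType) (g : nat) (H : set nat) : Prop :=
  ~ exists (n : nat) (X : smooth_curve R[i] n) (P Q : point X),
      [/\ has_genus X g, P <> Q, WS P = H & WS Q = H].

(* Main.v *)
Require Import Defs.
From HB Require Import structures.
From mathcomp Require Import all_boot all_order all_algebra.
From mathcomp Require Import generic_quotient ring_quotient fraction.
From mathcomp Require Import complex reals.
From mathcomp Require Import boolp classical_sets.
From mathcomp Require Import ring zify.
From mathcomp Require Import freeg mpoly.

(** Suppose WS(P) = WS(Q) = H with P <> Q.  If the pencils |aP| and |aQ| differ,
    then, a being prime, the powers 1, u, ..., u^(a-1) of a function u with pole
    divisor aQ are independent over k(x), x having pole divisor aP; counting the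
    monomials x^i u^j gives Castelnuovo's bound g <= (a-1)^2, contrary to the
    assumption on g.  So there is x with divisor aQ - aP.  Let y have pole divisor
    bP; subtracting a polynomial of degree at most n in x we may assume that a does
    not divide s = ord_Q y < (n+1)a.  Then y / x^(n+1) has its only pole at Q, of
    order (n+1)a - s, which lies in H and must be b; thus s = a - r.  Counting the
    monomials x^i y^j (i in Z, 0 <= j < a) in L(N a (P + Q)) now gives
    2 g <= (a-1)(b-s) = (a-1)(b-a+r), a contradiction.

    Both counts use l(D) <= deg D + 1 - g for l(D) large, where g is read off the
    Hilbert polynomial.  This rests on an elementary Nullstellensatz (every pair of
    coordinates satisfies a binary form modulo I + (B), since the Hilbert function
    of I grows linearly) and on the equality of (S/I)_m with the space of everywhere
    regular sections of O(m) for large m.  Uniformizers at all points come from a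
    function witnessing that a is in H. *)

Set Implicit Arguments.
Unset Strict Implicit.
Unset Printing Implicit Defensive.

Import Order.TTheory GRing.Theory Num.Theory.

Local Open Scope ring_scope.
Local Open Scope quotient_scope.

(** * Dimension and codimension of subspaces *)

(** All computation takes place in the fraction field of the homogeneous coordinate ring, where
    forms of every degree and functions live together. Dimensions enter only through independent
    families compared with the Hilbert function, which thereby yields the finiteness of zeros, the
    degree of a form and degree 0 of principal divisors. The independence of the powers of u is seen
    at P alone. Once x is normalised to vanish at Q, x^a u has poles only at P and can be reduced
    modulo polynomials in x. If the remainder has pole order prime to a, the orders of its first a
    powers are distinct modulo a. Otherwise x^a u is a polynomial in x, which forces Q to be the
    only zero of x. The bound (n+1)a in the hypothesis on H makes the pole order (n+1)a - s at Q a
    combination of a and b. The condition b > 3a makes (a-1)(b-a+r) at least 2(a-1)^2. In the last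
    count the exponents of x are rounded by the ceiling of rj/a, and these roundings pair up under j
    -> a-j because a is prime. *)

Section Dimension.
Variables (k K : fieldType) (cst : {rmorphism k -> K}).
Implicit Types (U V W : K -> Prop) (f g : K).

Definition subspace V := V 0 /\ forall c f g, V f -> V g -> V (cst c * f + g).

Definition lin_comb l (c : 'I_l -> k) (e : 'I_l -> K) := \sum_i cst (c i) * e i.

Definition dim_ge V l := exists2 e : 'I_l -> K, forall i, V (e i) &
  forall c, lin_comb c e = 0 -> forall i, c i = 0.

Definition codim_le V U q := exists e : 'I_q -> K,
  forall f, V f -> exists c, U (f - lin_comb c e).

Lemma subspaceZ V c f : subspace V -> V f -> V (cst c * f).
Proof. by move=> [V0 VD] Vf; rewrite -[_ * _]addr0; apply: VD. Qed.

Lemma subspaceD V f g : subspace V -> V f -> V g -> V (f + g).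
Proof.
by move=> [V0 VD] Vf Vg; rewrite -[f]mul1r -(rmorph1 cst); apply: VD.
Qed.

Lemma subspaceB V f g : subspace V -> V f -> V g -> V (f - g).
Proof.
by move=> [V0 VD] Vf Vg; rewrite addrC -mulN1r -(rmorphN1 cst); apply: VD.
Qed.

Lemma subspace_comb V l c (e : 'I_l -> K) :
  subspace V -> (forall i, V (e i)) -> V (lin_comb c e).
Proof.
move=> sV Ve; apply: (big_ind V); first by case: sV.
  by move=> x y; apply: subspaceD.
by move=> i _; apply: subspaceZ.
Qed.

Lemma subspace_zero : subspace (fun f => f = 0).
Proof. by split=> // c f g -> ->; rewrite mulr0 addr0. Qed.

Lemma lin_comb_mul l (c : 'I_l -> k) (e : 'I_l -> K) g :
  lin_comb c (fun i => g * e i) = g * lin_comb c e.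
Proof. by rewrite /lin_comb mulr_sumr; apply: eq_bigr => i _; rewrite mulrCA. Qed.

Lemma dim_ge_sub V W l : (forall f, V f -> W f) -> dim_ge V l -> dim_ge W l.
Proof. by move=> sVW [e Ve fe]; exists e => // i; apply: sVW. Qed.

Lemma dim_ge_fin (T : finType) V (e : T -> K) : (forall i, V (e i)) ->
  (forall c : T -> k, \sum_i cst (c i) * e i = 0 -> forall i, c i = 0) ->
  dim_ge V #|T|.
Proof.
move=> Ve fe; exists (fun i => e (enum_val i)) => // c c0 i.
have := fe (fun x => c (enum_rank x)); rewrite -(enum_valK i); apply.
rewrite -[RHS]c0 /lin_comb (reindex (@enum_val T T)) /=.
  by apply: eq_bigr => j _; rewrite enum_valK.
by exists enum_rank => x _; rewrite ?enum_valK ?enum_rankK.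
Qed.

Lemma dim_ge_mul V W l g : g != 0 -> (forall f, V f -> W (g * f)) ->
  dim_ge V l -> dim_ge W l.
Proof.
move=> g0 VW [e Ve fe]; exists (fun i => g * e i) => [i|c]; first exact: VW.
by rewrite lin_comb_mul => /eqP; rewrite mulf_eq0 (negPf g0) => /eqP/fe.
Qed.

Lemma dim_ge_leq V l l' : (l' <= l)%N -> dim_ge V l -> dim_ge V l'.
Proof.
move=> ll' [e Ve fe]; exists (fun i => e (widen_ord ll' i)) => // c c0 i.
pose c' (j : 'I_l) := if insub (j : nat) is Some j' then c j' else 0.
have c'E (j : 'I_l') : c' (widen_ord ll' j) = c j.
  by rewrite /c' /= valK.
rewrite -c'E; apply: fe; rewrite -[RHS]c0 /lin_comb.
pose F j := if insub (j : nat) is Some j' then cst (c' j') * e j' else 0.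
transitivity (\sum_(j < l) F j).
  by apply: eq_bigr => j _; rewrite /F valK.
transitivity (\sum_(j < l') F j); last first.
  apply: eq_bigr => j _; rewrite /F -c'E.
  have -> // : insub (j : nat) = Some (widen_ord ll' j).
  exact: (valK (widen_ord ll' j)).
rewrite (big_ord_widen l F ll') [LHS](bigID (fun j : 'I_l => (j < l')%N)) /=.
rewrite [X in _ + X]big1 ?addr0 // => j nj.
by rewrite /F valK /c' insubF ?rmorph0 ?mul0r //; apply/negbTE.
Qed.

Lemma dim_ge_cat U V p q (e : 'I_q -> K) : subspace U ->
  (forall f, U f -> V f) -> dim_ge U p -> (forall i, V (e i)) ->
  (forall c, U (lin_comb c e) -> forall i, c i = 0) -> dim_ge V (p + q).
Proof.
move=> sU UV [u Uu fu] Ve fe.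
exists (fun i => match split i with inl j => u j | inr j => e j end).
  by move=> i; case: split => j //; apply: UV.
move=> c; rewrite /lin_comb big_split_ord /=.
under eq_bigr => i _ do rewrite (unsplitK (inl i)).
under [X in _ + X]eq_bigr => i _ do rewrite (unsplitK (inr i)).
rewrite -/(lin_comb (fun i => c (lshift q i)) u).
rewrite -/(lin_comb (fun i => c (rshift p i)) e) => c0.
have c2 : forall i, c (rshift p i) = 0.
  apply: fe; rewrite (_ : lin_comb _ _ = - lin_comb (c \o lshift q) u).
    by rewrite -mulN1r -(rmorphN1 cst); apply: subspaceZ => //; apply: subspace_comb.
  by apply/eqP; rewrite -addr_eq0 addrC c0.
have c1 : forall i, c (lshift q i) = 0.
  apply: fu; rewrite -[RHS]c0 [X in _ + X]big1 ?addr0 // => i _.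
  by rewrite c2 rmorph0 mul0r.
by move=> i; rewrite -(splitK i); case: split => j /=; [apply: c1 | apply: c2].
Qed.

Lemma dim_ge_dependent U V p q (e : 'I_q -> K) : subspace U ->
  (forall f, U f -> V f) -> dim_ge U p -> (forall i, V (e i)) ->
  ~ dim_ge V (p + q) -> exists2 c, U (lin_comb c e) & exists i, c i != 0.
Proof.
move=> sU UV Up Ve nV; apply: contrapT => nc; apply: nV.
apply: (dim_ge_cat sU UV Up Ve) => c Uc i; apply: contrapT => /eqP ci.
by apply: nc; exists c => //; exists i.
Qed.

Lemma dim_ge_ext U V l f : subspace U -> (forall f, U f -> V f) -> V f -> ~ U f ->
  dim_ge U l -> dim_ge V l.+1.
Proof.
move=> sU UV Vf nUf Ul; rewrite -addn1.
apply: (dim_ge_cat (e := fun=> f) sU UV Ul) => // c; rewrite /lin_comb big_ord1.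
move=> Uc i; rewrite ord1; apply: contrapT => /eqP c0; apply: nUf.
rewrite -[f](mulKf (_ : cst (c ord0) != 0)) ?fmorph_eq0 //.
by rewrite -fmorphV; apply: subspaceZ.
Qed.

Lemma codim_le0 V U q : (forall f, V f -> U f) -> codim_le V U q.
Proof.
move=> VU; exists (fun=> 0) => f /VU Uf; exists (fun=> 0).
by rewrite /lin_comb big1 ?subr0 // => i _; rewrite mulr0.
Qed.

Lemma codim_le1 V U :
  (forall f0 f, V f0 -> V f -> U f0 \/ exists c, U (f - cst c * f0)) ->
  codim_le V U 1.
Proof.
move=> H; have [VU|/existsNP[f0 /not_implyP[Vf0 nUf0]]] :=
  pselect (forall f, V f -> U f); first exact: codim_le0.
exists (fun=> f0) => f Vf; have [//|[c Uc]] := H f0 f Vf0 Vf.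
by exists (fun=> c); rewrite /lin_comb big_ord1.
Qed.

Lemma codim_le_dim U V p q : subspace U -> subspace V ->
  (forall f, U f -> V f) -> dim_ge U p -> ~ dim_ge V (p + q).+1 ->
  codim_le V U q.
Proof.
elim: q => [|q IHq] in U p *; move=> sU sV UV Up nV.
  apply: codim_le0 => f Vf; apply: contrapT => nUf; apply: nV.
  by rewrite addn0; apply: (dim_ge_ext sU UV Vf).
have [VU|/existsNP[f0 /not_implyP[Vf0 nUf0]]] :=
  pselect (forall f, V f -> U f); first exact: codim_le0.
pose U' g := exists c, U (g - cst c * f0).
have sU' : subspace U'.
  split; first by exists 0; rewrite rmorph0 mul0r subr0; case: sU.
  move=> c f g [cf Uf] [cg Ug]; exists (c * cf + cg).
  rewrite (_ : _ - _ = cst c * (f - cst cf * f0) + (g - cst cg * f0)).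
    by case: sU => _; apply.
  rewrite rmorphD rmorphM /= mulrBr mulrDl mulrA opprD.
  by rewrite !addrA; congr (_ - _); rewrite addrAC.
have UU' f : U f -> U' f.
  by move=> Uf; exists 0; rewrite rmorph0 mul0r subr0.
have U'V f : U' f -> V f.
  move=> [c Uc]; rewrite -[f](subrK (cst c * f0)).
  by apply: subspaceD => //; [apply: UV | apply: subspaceZ].
have U'f0 : U' f0.
  by exists 1; rewrite rmorph1 mul1r subrr; case: sU.
have [] // := IHq U' p.+1 sU' sV U'V (dim_ge_ext sU UU' U'f0 nUf0 Up) _.
  by rewrite addSnnS.
move=> e He; exists (fun i => if unlift ord0 i is Some j then e j else f0).
move=> f /He[c [c0 Uc]].
exists (fun i => if unlift ord0 i is Some j then c j else c0).
rewrite /lin_comb big_ord_recl unlift_none opprD addrA addrAC.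
by under eq_bigr => i _ do rewrite !liftK.
Qed.

(** Let [C] record the coordinates modulo [U] of [p + q] independent vectors of [V]. Its left kernel
    has rank at least [p], and each kernel row gives a combination of these vectors lying in [U]. *)
Lemma dim_ge_codim V U p q : subspace U -> codim_le V U q ->
  dim_ge V (p + q) -> dim_ge U p.
Proof.
move=> sU [e He] [f Vf ff].
have /choice[c Uc] i : exists c, U (f i - lin_comb c e) by apply/He/Vf.
pose C := \matrix_(i, j) c i j.
have rC : (p <= \rank (kermx C))%N.
  by rewrite mxrank_ker leq_subRL ?rank_leq_row // addnC leq_add2l rank_leq_col.
apply: (dim_ge_leq rC).
pose R := row_base (kermx C); have RC : R *m C = 0.
  by apply/sub_kermxP; rewrite eq_row_base.
pose F i := lin_comb (fun a => R i a) f.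
exists F.
  move=> i; have -> : F i = lin_comb (fun a => R i a) (fun a => f a - lin_comb (c a) e).
    rewrite /F /lin_comb; under [RHS]eq_bigr do rewrite mulrBr.
    rewrite sumrB [X in _ - X](_ : _ = 0) ?subr0 //.
    under eq_bigr do rewrite mulr_sumr.
    rewrite exchange_big big1 // => j _ /=.
    under eq_bigr do rewrite mulrA -rmorphM.
    rewrite -mulr_suml -rmorph_sum.
    have := congr1 (fun A : 'M_(_, _) => A i j) RC.
    rewrite mxE [RHS in _ = RHS -> _]mxE => RCij.
    rewrite [X in cst X](_ : _ = 0) ?rmorph0 ?mul0r // -[RHS]RCij.
    by apply: eq_bigr => a _; rewrite [C a j]mxE.
  exact: subspace_comb.
move=> d d0 i.
have dR : (\row_i d i) *m R = 0.
  apply/rowP => j; rewrite mxE [RHS]mxE.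
  have H := ff (fun a => \sum_i d i * R i a).
  rewrite -[RHS](H _ j).
    by apply: eq_bigr => a _; rewrite [X in X * _]mxE.
  rewrite -[RHS]d0 /lin_comb /F /lin_comb.
  under eq_bigr do rewrite rmorph_sum mulr_suml.
  rewrite exchange_big; apply: eq_bigr => a _ /=; rewrite mulr_sumr.
  by apply: eq_bigr => b _; rewrite rmorphM mulrA.
have /row_freeP[B RB] : row_free R by apply: row_base_free.
have := congr1 (fun A => (A *m B) ord0 i) dR.
by rewrite -mulmxA RB mulmx1 mul0mx !mxE.
Qed.

Lemma codim_le_dimP V h : codim_le V (fun f => f = 0) h -> ~ dim_ge V h.+1.
Proof.
rewrite -add1n => cV /(dim_ge_codim subspace_zero cV)[e e0 /(_ (fun=> 1))].
rewrite /lin_comb big_ord1 e0 mulr0 => /(_ erefl ord0)/eqP.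
by rewrite oner_eq0.
Qed.

End Dimension.

(** * A projective Nullstellensatz *)

Lemma pihomogMr (n : nat) (R : comNzRingType) d e (p q : {mpoly R[n]}) :
  q \is e.-homog -> pihomog mdeg (d + e) (p * q) = pihomog mdeg d p * q.
Proof.
move=> hq; have /pihomog_partitionE pE := leq_maxr d.+1 (mmeasure mdeg p).
rewrite {1}pE.
have dm : (d < maxn d.+1 (mmeasure mdeg p))%N by rewrite leq_maxl.
rewrite mulr_suml raddf_sum (bigD1 (Ordinal dm)) //= big1 ?addr0.
  by rewrite pihomog_dE // dhomogM ?pihomogP.
move=> i ni; apply: (@pihomog_ne0 _ _ _ (i + e)%N); last by rewrite dhomogM ?pihomogP.
by rewrite eqn_add2r; apply: contra ni => /eqP ij; apply/eqP/val_inj.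
Qed.

Section BinaryForm.
Variables (k : fieldType) (S : comAlgType k) (x y : S).

(** The homogenization of [p] in degree [D]. Coefficients of index above [D] are cut off, hence the
    size conditions below. *)
Definition binary_form D (p : {poly k}) : S :=
  \sum_(s < D.+1) p`_s *: (x ^+ s * y ^+ (D - s)).

Lemma binary_formM D a (q : {poly k}) : (size q <= D.+1)%N ->
  binary_form D.+1 (('X - a%:P) * q) = (x - a *: y) * binary_form D q.
Proof.
move=> sq; rewrite mulrBl.
transitivity (binary_form D.+1 ('X * q) - a *: binary_form D.+1 q).
  rewrite /binary_form scaler_sumr -sumrB; apply: eq_bigr => s _.
  by rewrite coefB coefCM scalerBl scalerA.
rewrite mulrBl; congr (_ - _).
  rewrite /binary_form big_ord_recl coefXM /= scale0r add0r mulr_sumr.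
  apply: eq_bigr => s _; rewrite coefXM /= subSS exprS -scalerAr mulrA.
  by [].
rewrite /binary_form big_ord_recr /= [q`_D.+1]nth_default // scale0r addr0.
rewrite -scalerAl mulr_sumr; congr (_ *: _); apply: eq_bigr => s _.
by rewrite -scalerAr subSn ?leq_ord // exprS mulrCA.
Qed.

Lemma binary_form_prod D (rs : seq k) : (size rs <= D)%N ->
  binary_form D (\prod_(a <- rs) ('X - a%:P)) =
  \prod_(a <- rs) (x - a *: y) * y ^+ (D - size rs).
Proof.
elim: rs D => [|a rs IHrs] D /= sD.
  rewrite !big_nil mul1r subn0 /binary_form big_ord_recl coef1 /= scale1r mul1r subn0.
  by rewrite big1 ?addr0 // => i _; rewrite coef1 /= scale0r.
case: D sD => // D sD; rewrite !big_cons binary_formM ?IHrs ?subSS ?mulrA //.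
by rewrite size_prod_XsubC ltnS.
Qed.

Lemma binary_formZ D c p : binary_form D (c *: p) = c *: binary_form D p.
Proof.
by rewrite /binary_form scaler_sumr; apply: eq_bigr => s _; rewrite coefZ scalerA.
Qed.

End BinaryForm.

Section Nullstellensatz.
Variables (k : closedFieldType) (n : nat).
Implicit Types (J : {mpoly k[n]} -> Prop) (F G H : {mpoly k[n]}).

Definition ideal_set J := [/\ J 0, forall F G, J F -> J G -> J (F + G)
  & forall H F, J F -> J (H * F)].

Lemma idealB J F G : ideal_set J -> J F -> J G -> J (F - G).
Proof. by move=> [_ JD JM] JF JG; apply: JD => //; rewrite -mulN1r; apply: JM. Qed.

Lemma idealZ J c F : ideal_set J -> J F -> J (c *: F).
Proof. by move=> [_ _ JM] JF; rewrite -mul_mpolyC; apply: JM. Qed.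

Lemma ideal_sum J (I : Type) (r : seq I) (P : pred I) (F : I -> {mpoly k[n]}) :
  ideal_set J -> (forall i, P i -> J (F i)) -> J (\sum_(i <- r | P i) F i).
Proof. by move=> [J0 JD _] JF; apply: (big_ind J). Qed.

Definition adjoin J G F := exists H, J (F - H * G).

Lemma adjoin_ideal J G : ideal_set J -> ideal_set (adjoin J G).
Proof.
move=> [J0 JD JM]; split; first by exists 0; rewrite mul0r subr0.
  move=> F1 F2 [H1 J1] [H2 J2]; exists (H1 + H2).
  by rewrite mulrDl opprD addrACA; apply: JD.
by move=> H F [H1 J1]; exists (H * H1); rewrite -mulrA -mulrBr; apply: JM.
Qed.

Lemma adjoin_sub J G F : J F -> adjoin J G F.
Proof. by exists 0; rewrite mul0r subr0. Qed.

Lemma adjoin_gen J G : ideal_set J -> adjoin J G G.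
Proof. by move=> [J0 _ _]; exists 1; rewrite mul1r subrr. Qed.

Definition not_nilpotent J (i : 'I_n) := forall N, ~ J ('X_i ^+ N).

(** If ['X_i ^+ N] is a multiple of one linear factor modulo [J], that factor can be traded in the
    product for a power of ['X_i]. Trading all of them would make ['X_i] nilpotent. *)
Lemma not_nilpotent_root J i l (rs : seq k) e : ideal_set J ->
  not_nilpotent J i -> J (\prod_(a <- rs) ('X_l - a *: 'X_i) * 'X_i ^+ e) ->
  exists a, not_nilpotent (adjoin J ('X_l - a *: 'X_i)) i.
Proof.
move=> iJ nJ; elim: rs e => [|a rs IHrs] e.
  by rewrite big_nil mul1r => /nJ.
rewrite big_cons => Ja; have [|nn] := pselect (not_nilpotent (adjoin J ('X_l - a *: 'X_i)) i).
  by exists a.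
move/existsNP: nn => [N /contrapT[H JN]]; apply: (IHrs (N + e)%N).
set A := 'X_l - _ in Ja JN; set B := \prod_(j <- rs) _ in Ja *.
rewrite (_ : B * _ = B * 'X_i ^+ e * ('X_i ^+ N - H * A) + H * (A * B * 'X_i ^+ e)).
  by case: iJ => _ JD JM; apply: JD; apply: JM.
by rewrite exprD; ring.
Qed.

Definition has_binary_forms J := forall i l : 'I_n, exists2 p : {poly k}, p != 0 &
  exists2 D, (size p <= D.+1)%N & J (binary_form ('X_l : {mpoly k[n]}) 'X_i D p).

Lemma not_nilpotent_adjoin J i l : ideal_set J -> has_binary_forms J ->
  not_nilpotent J i -> exists a, not_nilpotent (adjoin J ('X_l - a *: 'X_i)) i.
Proof.
move=> iJ /(_ i l)[p p0 [D sp Jp]] nJ.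
have [rs pE] := closed_field_poly_normal p.
move: Jp; rewrite pE binary_formZ binary_form_prod; last first.
  by move: sp; rewrite {1}pE size_scale ?lead_coef_eq0 // size_prod_XsubC.
move/(idealZ (lead_coef p)^-1 iJ); rewrite scalerA mulVf ?lead_coef_eq0 // scale1r.
exact: not_nilpotent_root.
Qed.

(** Adjoining one form ['X_l - a *: 'X_i] per coordinate, while ['X_i] stays non-nilpotent, produces
    the coordinates [v] of a common zero of the forms in [J]. *)
Lemma not_nilpotent_point J i : ideal_set J -> has_binary_forms J ->
  not_nilpotent J i ->
  exists v : 'I_n -> k, exists J', [/\ ideal_set J', forall F, J F -> J' F,
    not_nilpotent J' i & forall l, J' ('X_l - v l *: 'X_i)].
Proof.
move=> iJ bJ nJ.
suff H (s : seq 'I_n) : exists v : 'I_n -> k, exists J', [/\ ideal_set J',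
    forall F, J F -> J' F, not_nilpotent J' i
    & forall l, l \in s -> J' ('X_l - v l *: 'X_i)].
  have [v [J' [iJ' JJ' nJ' vJ']]] := H (enum 'I_n); exists v, J'; split => // l.
  by apply: vJ'; rewrite mem_enum.
elim: s => [|l s [v [J' [iJ' JJ' nJ' vJ']]]]; first by exists (fun=> 0), J.
have bJ' : has_binary_forms J'.
  by move=> a b; have [p p0 [D sp Jp]] := bJ a b; exists p => //; exists D => //; apply: JJ'.
have [a na] := not_nilpotent_adjoin l iJ' bJ' nJ'.
exists (fun j => if j == l then a else v j), (adjoin J' ('X_l - a *: 'X_i)); split=> //.
- exact: adjoin_ideal.
- by move=> F /JJ' J'F; apply: adjoin_sub.
move=> j; case: eqVneq => [-> _|jl]; first exact: adjoin_gen.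
by rewrite inE (negPf jl) => /vJ' ?; apply: adjoin_sub.
Qed.

Lemma ideal_cong_homog J (v : 'I_n -> k) i d F : ideal_set J ->
  (forall l, J ('X_l - v l *: 'X_i)) -> F \is d.-homog ->
  J (F - F.@[v] *: 'X_i ^+ d).
Proof.
move=> iJ vJ /dhomogP hF; rewrite {1}[F]mpolyE mevalE scaler_suml -sumrB big_seq.
apply: ideal_sum => // m /hF dm; rewrite -scalerA -scalerBr; apply: idealZ => //.
case: (iJ) => J0 JD JM.
have congM a b c e : J (a - b) -> J (c - e) -> J (a * c - b * e).
  move=> ab ce; rewrite -(subrKA (a * e)) -mulrBr -mulrBl.
  by apply: JD; [apply: JM | rewrite mulrC; apply: JM].
rewrite (_ : _ *: _ = \prod_l (v l *: 'X_i) ^+ m l).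
  rewrite mpolyXE_id; apply: (big_ind2 (fun a b => J (a - b))).
  - by rewrite subrr.
  - by move=> a b c e; apply: congM.
  move=> l _; elim: (m l) => [|N IHN]; first by rewrite !expr0 subrr.
  by rewrite !exprS; apply: congM.
under [RHS]eq_bigr do rewrite exprZn.
by rewrite scaler_prod prodrXr -mdegE dm.
Qed.

Lemma projective_nullstellensatz J : ideal_set J -> has_binary_forms J ->
  (forall v : 'I_n -> k, (exists i, v i != 0) ->
     exists d F, [/\ F \is d.-homog, J F & F.@[v] != 0]) ->
  exists e0, forall e F, (e0 <= e)%N -> F \is e.-homog -> J F.
Proof.
move=> iJ bJ noP; have [J0 JD JM] := iJ.
have nil i : exists N, J ('X_i ^+ N).
  apply: contrapT => nN.
  have nJ : not_nilpotent J i by move=> N JN; apply: nN; exists N.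
  have [v [J' [iJ' JJ' nJ' vJ']]] := not_nilpotent_point iJ bJ nJ.
  have vi : v i != 0.
    apply/eqP => v0; apply: (nJ' 1%N); rewrite expr1.
    by have := vJ' i; rewrite v0 scale0r subr0.
  have [d [F [hF JF Fv]]] := noP v (ex_intro _ i vi).
  apply: (nJ' d); have := idealB iJ' (JJ' _ JF) (ideal_cong_homog iJ' vJ' hF).
  rewrite subKr => /(idealZ (F.@[v])^-1 iJ').
  by rewrite scalerA mulVf // scale1r.
(* Pigeonhole: a monomial of degree above [n * M] has an exponent at least [M], hence is divisible
   by a power of a variable that lies in [J]. *)
have [N NP] := choice nil; pose M := (\max_i N i)%N.
exists (n * M).+1 => e F eM /dhomogP hF; rewrite [F]mpolyE big_seq.
apply: ideal_sum => // m /hF dm; apply: idealZ => //.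
have dm' : (\sum_i m i)%N = e by rewrite -mdegE.
have [i Mi] : exists i, (M <= m i)%N.
  apply: contrapT => /forallNP nM; move: eM; rewrite -dm' ltnNge => /negP[].
  rewrite -[X in (X * M)%N]card_ord -sum_nat_const; apply: leq_sum => i _.
  by rewrite ltnW // ltnNge; apply/negP/nM.
rewrite mpolyXE_id (bigD1 i) //= mulrC; apply: (JM).
rewrite -(subnK (leq_trans (leq_bigmax i) Mi)) exprD; exact: JM.
Qed.

End Nullstellensatz.

(** * Orders of vanishing and Riemann's inequality *)

Section Curve.
Variables (k : closedFieldType) (n : nat) (K : fieldType).
Variable iota : {rmorphism {mpoly k[n.+1]} -> K}.
Variables (pt : eqType) (co : pt -> 'I_n.+1 -> k) (piv : pt -> 'I_n.+1).
Variables (t : pt -> K).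
Implicit Types (v w : pt) (F G A B C : {mpoly k[n.+1]}) (D : seq pt).
Implicit Types (s : K) (j : int).

Definition scal : {rmorphism k -> K} := iota \o @mpolyC n.+1 k.

Definition section_space (m : nat) s :=
  exists2 F : {mpoly k[n.+1]}, F \is m.-homog & s = iota F.

(** The value of a function at [v], as a relation: [f] is in the local ring when some [c] exists,
    and in its maximal ideal when [c] is 0. It is single-valued by [ev_uniq]. *)
Definition ev v f c := exists (e : nat) (F G : {mpoly k[n.+1]}),
  [/\ F \is e.-homog, G \is e.-homog, G.@[co v] != 0,
      f = iota F / iota G & c = F.@[co v] / G.@[co v]].

Definition xcoord v : K := iota 'X_(piv v).

(* [s], seen as a rational section of O(j), has order at least (resp. exactly)
   [m] at [v]; [xcoord v] trivializes O(1) at [v]. *)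
Definition ordge v j (m : int) s :=
  exists h c, ev v h c /\ s = h * xcoord v ^ j * t v ^ m.
Definition ordeq v j (m : int) s :=
  exists h c, [/\ ev v h c, c != 0 & s = h * xcoord v ^ j * t v ^ m].

Hypothesis iota_homog : forall F (d : nat), iota F = 0 -> iota (pihomog mdeg d F) = 0.
Hypothesis co_on : forall v F, iota F = 0 -> F.@[co v] = 0.
Hypothesis co_piv : forall v, co v (piv v) = 1.
Hypothesis co_sep : forall v w, v != w ->
  exists2 F, F \is 1.-homog & F.@[co v] != 0 /\ F.@[co w] = 0.
Hypothesis co_complete : forall u : 'I_n.+1 -> k, (exists a, u a != 0) ->
  (forall F, iota F = 0 -> F.@[u] = 0) ->
  exists v (c : k), forall a, u a = c * co v a.
Hypothesis t_neq0 : forall v, t v != 0.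
Hypothesis t_max : forall v, ev v (t v) 0.
Hypothesis t_gen : forall v f, ev v f 0 -> exists h c, ev v h c /\ f = h * t v.

(** * Values and orders at a point *)

Lemma iota_neq0 v F : F.@[co v] != 0 -> iota F != 0.
Proof. by apply: contraNneq => /(co_on v) ->. Qed.

Lemma scalE c : scal c = iota c%:MP. Proof. by []. Qed.

Lemma ev_uniq v f c c' : ev v f c -> ev v f c' -> c = c'.
Proof.
move=> [e [F [G [_ _ G0 -> ->]]]] [e' [F' [G' [_ _ G0' E ->]]]].
move: E => /eqP; rewrite eqr_div ?(iota_neq0 G0) ?(iota_neq0 G0') //.
rewrite -!rmorphM -subr_eq0 -rmorphB => /eqP /(co_on v).
by rewrite mevalB !mevalM => /eqP; rewrite subr_eq0 -eqr_div // => /eqP.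
Qed.

Lemma ev_scal v c : ev v (scal c) c.
Proof.
exists 0%N, c%:MP, 1; split; rewrite ?mevalC ?meval1 ?oner_eq0 ?divr1 //.
- by rewrite -alg_mpolyC; apply/dhomogZ/dhomog1.
- exact: dhomog1.
- by rewrite rmorph1 divr1 scalE.
Qed.

Lemma evD v f c f' c' : ev v f c -> ev v f' c' -> ev v (f + f') (c + c').
Proof.
move=> [e [F [G [hF hG G0 -> ->]]]] [e' [F' [G' [hF' hG' G0' -> ->]]]].
exists (e + e')%N, (F * G' + F' * G), (G * G'); split.
- by apply: dhomogD; [apply: dhomogM | rewrite addnC; apply: dhomogM].
- exact: dhomogM.
- by rewrite mevalM mulf_neq0.
- by rewrite addf_div ?(iota_neq0 G0) ?(iota_neq0 G0') // rmorphD !rmorphM.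
- by rewrite addf_div // mevalD !mevalM.
Qed.

Lemma evM v f c f' c' : ev v f c -> ev v f' c' -> ev v (f * f') (c * c').
Proof.
move=> [e [F [G [hF hG G0 -> ->]]]] [e' [F' [G' [hF' hG' G0' -> ->]]]].
exists (e + e')%N, (F * F'), (G * G'); split; rewrite ?dhomogM //.
- by rewrite mevalM mulf_neq0.
- by rewrite mulf_div !rmorphM.
- by rewrite mulf_div !mevalM.
Qed.

Lemma evV v f c : c != 0 -> ev v f c -> ev v f^-1 c^-1.
Proof.
move=> c0 [e [F [G [hF hG G0 -> cE]]]]; exists e, G, F; split => //.
- by apply: contra c0; rewrite cE => /eqP ->; rewrite mul0r.
- by rewrite invf_div.
- by rewrite cE invf_div.
Qed.

Lemma ev1 v : ev v 1 1.
Proof. by have := ev_scal v 1; rewrite rmorph1. Qed.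

Lemma ev0 v : ev v 0 0.
Proof. by have := ev_scal v 0; rewrite rmorph0. Qed.

Lemma evZD v c f a g b : ev v f a -> ev v g b -> ev v (scal c * f + g) (c * a + b).
Proof. by move=> fa gb; apply: evD => //; apply: evM => //; apply: ev_scal. Qed.

Lemma xcoord_neq0 v : xcoord v != 0.
Proof. by apply: (@iota_neq0 v); rewrite mevalXU co_piv oner_eq0. Qed.
Hint Resolve t_neq0 xcoord_neq0 : core.

Lemma ordeq_ge v j m s : ordeq v j m s -> ordge v j m s.
Proof. by move=> [h [c [hc _ E]]]; exists h, c. Qed.

Lemma ordeq_neq0 v j m s : ordeq v j m s -> s != 0.
Proof.
move=> [h [c [hc c0 ->]]]; rewrite !mulf_neq0 ?expfz_neq0 //.
by apply: contra c0 => /eqP h0; apply/eqP/(ev_uniq hc); rewrite h0; apply: ev0.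
Qed.

Lemma ordgeM v j m s j' m' s' : ordge v j m s -> ordge v j' m' s' ->
  ordge v (j + j') (m + m') (s * s').
Proof.
move=> [h [c [hc ->]]] [h' [c' [hc' ->]]]; exists (h * h'), (c * c').
split; first exact: evM.
by rewrite !expfzDr //; ring.
Qed.

Lemma ordeqM v j m s j' m' s' : ordeq v j m s -> ordeq v j' m' s' ->
  ordeq v (j + j') (m + m') (s * s').
Proof.
move=> [h [c [hc c0 ->]]] [h' [c' [hc' c0' ->]]]; exists (h * h'), (c * c').
split; [exact: evM | exact: mulf_neq0 |].
by rewrite !expfzDr //; ring.
Qed.

Lemma ordeqV v j m s : ordeq v j m s -> ordeq v (- j) (- m) s^-1.
Proof.
move=> [h [c [hc c0 ->]]]; exists h^-1, c^-1; split; rewrite ?invr_eq0 //.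
  exact: evV.
by rewrite !invfM !invr_expz.
Qed.

Lemma ordeqX v m s (e : nat) : ordeq v 0 m s -> ordeq v 0 (m * e%:Z) (s ^+ e).
Proof.
move=> os; elim: e => [|e IHe].
  rewrite mulr0; exists 1, 1; split; [exact: ev1 | exact: oner_neq0 |].
  by rewrite !expr0z !mulr1 expr0.
by rewrite exprS intS mulrDr mulr1; have := ordeqM os IHe; rewrite addr0.
Qed.

Lemma ordge_subspace v j m : subspace scal (ordge v j m).
Proof.
split; first by exists 0, 0; split; [exact: ev0 | rewrite !mul0r].
move=> c s s' [h [a [ha ->]]] [h' [a' [ha' ->]]].
exists (scal c * h + h'), (c * a + a'); split; first exact: evZD.
by ring.
Qed.

Lemma ev_tX v (e : nat) : exists c, ev v (t v ^+ e) c.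
Proof.
elim: e => [|e [c IHe]]; first by exists 1; rewrite expr0; apply: ev1.
by exists (0 * c); rewrite exprS; apply: evM.
Qed.

Lemma ordgeW v j m m' s : m' <= m -> ordge v j m s -> ordge v j m' s.
Proof.
move=> mm' [h [c [hc ->]]]; have [c' tc] := ev_tX v `|m - m'|%N.
exists (h * t v ^+ `|m - m'|%N), (c * c'); split; first exact: evM.
rewrite -{1}[m](subrK m') expfzDr // -[m - m' in LHS]gez0_abs ?subr_ge0 //.
rewrite -exprnP; ring.
Qed.

Lemma ordge_step v j m s : ordge v j m s -> ordeq v j m s \/ ordge v j (m + 1) s.
Proof.
move=> [h [c [hc ->]]]; have [c0|c0] := eqVneq c 0; last by left; exists h, c.
right; move: hc; rewrite c0 => /t_gen[h' [c' [hc' ->]]].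
by exists h', c'; split => //; rewrite expfzDr // expr1z; ring.
Qed.

Lemma ordeq_geN v j m s : ordeq v j m s -> ~ ordge v j (m + 1) s.
Proof.
move=> [h [c [hc c0 ->]]] [h' [c' [hc']]].
rewrite expfzDr // expr1z => E; have hE : h = h' * t v.
  apply: (mulIf (_ : xcoord v ^ j * t v ^ m != 0)).
    by rewrite mulf_neq0 ?expfz_neq0.
  by rewrite mulrA E; ring.
move: hc; rewrite hE => hc; move/eqP: c0; apply; apply: (ev_uniq hc).
by have := evM hc' (t_max v); rewrite mulr0.
Qed.

Lemma ordeq_ge_le v j m m' s : ordeq v j m s -> ordge v j m' s -> m' <= m.
Proof.
move=> os os'; rewrite leNgt; apply/negP => mm'; apply: (ordeq_geN os).
by apply: ordgeW os'; rewrite -lezD1 in mm' *.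
Qed.

(** The residue field at [v] is [k], so a multiple of [s0] cancels the leading term of [s] unless
    [s0] itself vanishes further. One more order of vanishing thus costs at most one dimension. *)
Lemma ordge_codim v j m s0 s : ordge v j m s0 -> ordge v j m s ->
  ordge v j (m + 1) s0 \/ exists c, ordge v j (m + 1) (s - scal c * s0).
Proof.
move=> o0 [h [c [hc ->]]]; case: (ordge_step o0) => [|?]; last by left.
move=> [h0 [c0 [hc0 c0N ->]]]; right; exists (c / c0).
have : ev v (scal (- (c / c0)) * h0 + h) 0.
  by have := evZD (- (c / c0)) hc0 hc; rewrite mulNr divfK // addNr.
move/t_gen => [h' [c' [hc' E]]]; exists h', c'; split => //.
rewrite expfzDr // expr1z; transitivity ((h' * t v) * xcoord v ^ j * t v ^ m).
  by rewrite -E rmorphN; ring.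
by ring.
Qed.

(** * Forms with prescribed vanishing *)

Lemma var_homog (a : 'I_n.+1) : ('X_a : {mpoly k[n.+1]}) \is 1.-homog.
Proof. by rewrite dhomogX; apply/eqP/mdeg1. Qed.

Lemma piv_form_homog v (e : nat) :
  ('X_(piv v) ^+ e : {mpoly k[n.+1]}) \is e.-homog.
Proof.
by rewrite -[e in e.-homog]mul1n; apply: dhomogMn; apply: var_homog.
Qed.

Lemma piv_form_eval v (e : nat) : ('X_(piv v) ^+ e).@[co v] = 1.
Proof. by rewrite rmorphXn /= mevalXU co_piv expr1n. Qed.

Lemma ev_form v (e : nat) F : F \is e.-homog ->
  ev v (iota F / xcoord v ^+ e) F.@[co v].
Proof.
move=> hF; exists e, F, ('X_(piv v) ^+ e).
rewrite piv_form_eval oner_eq0 divr1 rmorphXn; split=> //.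
exact: piv_form_homog.
Qed.

Lemma ordeq_form v (e : nat) F : F \is e.-homog -> F.@[co v] != 0 ->
  ordeq v e 0 (iota F).
Proof.
move=> hF F0; exists (iota F / xcoord v ^+ e), F.@[co v].
split=> //; first exact: ev_form.
by rewrite expr0z mulr1 -exprnP divfK // expf_neq0.
Qed.

Lemma ordge_form v (e : nat) F : F \is e.-homog -> ordge v e 0 (iota F).
Proof.
move=> hF; exists (iota F / xcoord v ^+ e), F.@[co v].
split=> //; first exact: ev_form.
by rewrite expr0z mulr1 -exprnP divfK // expf_neq0.
Qed.

Lemma ordge_form_root v (e : nat) F : F \is e.-homog -> F.@[co v] = 0 ->
  ordge v e 1 (iota F).
Proof.
move=> hF F0; have := ev_form v hF; rewrite F0 => /t_gen [h [c [hc E]]]; exists h, c; split=> //.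
by rewrite expr1z mulrAC -E -exprnP divfK // expf_neq0.
Qed.

(** Take the numerator of [t v], since its denominator does not vanish at [v]. *)
Lemma uniformizing_form v : exists (e : nat) F, F \is e.-homog /\ ordeq v e 1 (iota F).
Proof.
have [e [F [G [hF hG G0 tE _]]]] := t_max v.
exists e, F; split=> //; have [h [c [hc c0 E]]] := ordeq_form hG G0.
exists h, c; split=> //; rewrite expr1z tE mulrC.
by move: E; rewrite expr0z mulr1 => <-; rewrite divfK // (iota_neq0 G0).
Qed.

(** Effective divisors are lists of points; the coefficient is an integer because it is compared
    with orders. *)
Definition mult v D : int := count_mem v D.

Lemma mult_cons v w D : mult v (w :: D) = (w == v)%:Z + mult v D.
Proof. by rewrite /mult /= PoszD. Qed.

Definition vanish D j s := forall v, ordge v j (mult v D) s.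

(** A product with one factor per point of [D]: a form of order one for each copy of [v], and a
    linear form through [w] avoiding [v] for each other [w]. It serves to show that points impose
    independent conditions in large degree. *)
Lemma prescribed_form D v : exists m1, forall e, (m1 <= e)%N ->
  exists A, [/\ A \is e.-homog, vanish D e (iota A) & ordeq v e (mult v D) (iota A)].
Proof.
elim: D => [|w D [m1 IH]].
  exists 0%N => e _; have hX := piv_form_homog v e.
  exists ('X_(piv v) ^+ e); split=> [//|u|]; first exact: ordge_form.
  by apply: ordeq_form => //; rewrite piv_form_eval oner_eq0.
have [->|wv] := eqVneq w v.
  have [b [T [hT oT]]] := uniformizing_form v.
  exists (m1 + b)%N => e eb; have [|A [hA vA oA]] := IH (e - b)%N.
    by rewrite leq_subRL ?(leq_trans _ eb) ?leq_addl // addnC.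
  have eE : e = (b + (e - b))%N by rewrite subnKC // (leq_trans _ eb) ?leq_addl.
  exists (T * A); rewrite eE; split; first exact: dhomogM.
    move=> u; rewrite mult_cons rmorphM PoszD; apply: ordgeM => //.
    by have [<-|_] := eqVneq v u; [apply: ordeq_ge | apply: ordge_form].
  by rewrite mult_cons eqxx rmorphM PoszD; apply: ordeqM.
have [L hL [Lv Lw]] : exists2 L, L \is 1.-homog & L.@[co v] != 0 /\ L.@[co w] = 0.
  by apply: co_sep; rewrite eq_sym.
exists m1.+1 => -[//|e]; rewrite ltnS => /IH[A [hA vA oA]].
exists (L * A); rewrite -(add1n e); split; first exact: dhomogM.
  move=> u; rewrite mult_cons rmorphM PoszD; apply: ordgeM => //.
  by have [<-|_] := eqVneq w u; [apply: ordge_form_root | apply: ordge_form].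
by rewrite mult_cons (negPf wv) rmorphM PoszD; apply: ordeqM => //; apply: ordeq_form.
Qed.

Lemma section_space_subspace (e : nat) : subspace scal (section_space e).
Proof.
split; first by exists 0; rewrite ?dhomog0 ?rmorph0.
move=> c s s' [F hF ->] [F' hF' ->]; exists (c *: F + F').
  by rewrite dhomogD // dhomogZ.
by rewrite rmorphD -mul_mpolyC rmorphM.
Qed.

Lemma subspaceI U V : subspace scal U -> subspace scal V ->
  subspace scal (fun s => U s /\ V s).
Proof.
move=> [U0 UD] [V0 VD]; split=> // c f g [Uf Vf] [Ug Vg].
by split; [apply: UD | apply: VD].
Qed.

Lemma subspace_orders j (b : pt -> int) :
  subspace scal (fun s => forall v, ordge v j (b v) s).
Proof.
by split=> [v|c f g Hf Hg v]; have [o0 oD] := ordge_subspace v j (b v); [|apply: oD].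
Qed.

Lemma vanish_subspace D j : subspace scal (vanish D j).
Proof. exact: subspace_orders. Qed.

Lemma dim_ge_orders V j (b : pt -> int) D p : subspace scal V ->
  (forall s, V s -> forall v, ordge v j (b v) s) ->
  dim_ge scal V (p + size D) ->
  dim_ge scal (fun s => V s /\ forall v, ordge v j (b v + mult v D) s) p.
Proof.
move=> sV Vb; elim: D p => [|w D IH] p /=.
  rewrite addn0; apply: dim_ge_sub => s Vs; split=> // v.
  by rewrite addr0; apply: Vb.
rewrite addnS -addSn => /IH; rewrite -addn1; apply: dim_ge_codim.
  by apply: subspaceI => //; apply: subspace_orders.
apply: codim_le1 => s0 s [Vs0 os0] [Vs os].
have E v : w != v -> b v + mult v (w :: D) = b v + mult v D.
  by rewrite mult_cons => /negPf ->; rewrite add0r.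
have Ew : b w + mult w (w :: D) = b w + mult w D + 1.
  by rewrite mult_cons eqxx [1%:Z + _]addrC addrA.
case: (ordge_codim (os0 w) (os w)) => [o|[c o]]; [left|right].
  by split=> // v; have [<-|/E ->] := eqVneq w v; rewrite ?Ew.
exists c; split; first exact: subspaceB sV Vs (subspaceZ c sV Vs0).
move=> v; have [<-|/E ->] := eqVneq w v; first by rewrite Ew.
have sO := ordge_subspace v j (b v + mult v D).
exact: subspaceB sO (os v) (subspaceZ c sO (os0 v)).
Qed.

(** * The Hilbert function and the zeros of a form *)

Variables (deg genus m0 : nat) (p0 : pt).
Hypothesis hilb : forall m h : nat, (m0 <= m)%N ->
  dim_ge scal (section_space m) h <-> (h + genus <= deg * m + 1)%N.

Lemma hilb_max (m : nat) : (m0 <= m)%N ->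
  exists2 h : nat, dim_ge scal (section_space m) h & (h + genus = deg * m + 1)%N.
Proof.
(* The empty family gives [genus <= deg * m + 1], so the truncated subtraction below is exact. *)
move=> mm; have : (0 + genus <= deg * m + 1)%N.
  by apply/(hilb 0%N mm); exists (fun=> 0) => [|c _ []//]; case.
rewrite add0n => gm; exists (deg * m + 1 - genus)%N; last by rewrite subnK.
by apply/hilb; rewrite ?subnK.
Qed.

Lemma section_spaceM (e e' : nat) F s : F \is e.-homog -> section_space e' s ->
  section_space (e + e') (iota F * s).
Proof. by move=> hF [A hA ->]; exists (F * A); rewrite ?dhomogM ?rmorphM. Qed.

(** [prescribed_form D w] supplies a form vanishing along [D] but not along [w :: D], so every
    further point strictly lowers the dimension. *)
Lemma dim_ge_vanish D : exists m1, forall (e l : nat), (m1 <= e)%N ->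
  dim_ge scal (fun s => section_space e s /\ vanish D e s) l ->
  dim_ge scal (section_space e) (l + size D).
Proof.
elim: D => [|w D [m1 IH]].
  by exists 0%N => e l _; rewrite addn0; apply: dim_ge_sub => s [].
have [m2 H2] := prescribed_form D w.
exists (maxn m1 m2) => e l; rewrite geq_max => /andP[e1 e2] dl.
rewrite addnS -addSn; apply: IH => //.
have [A [hA vA oA]] := H2 e e2.
apply: (dim_ge_ext (f := iota A)) dl.
- by apply: subspaceI; [apply: section_space_subspace | apply: vanish_subspace].
- move=> s [Ms vs]; split=> // v; apply: ordgeW (vs v).
  by rewrite mult_cons lerDr.
- by split=> //; exists A.
move=> [_ /(_ w)]; rewrite mult_cons eqxx addrC.
exact: ordeq_geN.
Qed.

(** Multiplication by [F] embeds the forms of degree [m0 + m1] into those of degree [m0 + m1 + e]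
    that vanish along [D]. In the comparison of the two Hilbert values the genus cancels. *)
Lemma vanish_size D e F : F \is e.-homog -> iota F != 0 ->
  vanish D e (iota F) -> (size D <= deg * e)%N.
Proof.
move=> hF F0 vF; have [m1 H1] := dim_ge_vanish D.
pose m := (m0 + m1 + e)%N.
have [h dh hE] := @hilb_max (m0 + m1) (leq_addr _ _).
have /hilb : dim_ge scal (section_space m) (h + size D).
  apply: H1; first by rewrite /m; lia.
  apply: dim_ge_mul F0 _ dh => s Ms; split.
    by rewrite /m addnC; apply: section_spaceM.
  move=> v; rewrite /m addnC PoszD -[mult v D]addr0; apply: ordgeM => //.
  by case: Ms => A hA ->; apply: ordge_form.
have mm : (m0 <= m)%N by rewrite /m; lia.
by move/(_ mm); rewrite /m; lia.
Qed.

(** By [vanish_size] the lists along which [F] vanishes have bounded size, and one of maximal size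
    records the exact orders. In particular [F] has finitely many zeros. *)
Lemma form_divisor_le e F : F \is e.-homog -> iota F != 0 ->
  exists2 D, forall v, ordeq v e (mult v D) (iota F) & (size D <= deg * e)%N.
Proof.
move=> hF F0.
pose Q (l : nat) := `[< exists2 D, size D = l & vanish D e (iota F) >].
have Q0 : exists l, Q l.
  by exists 0%N; apply/asboolP; exists [::] => // v; apply: ordge_form.
have Qb l : Q l -> (l <= deg * e)%N.
  by move=> /asboolP[D <- vD]; apply: vanish_size vD.
case: (ex_maxnP Q0 Qb) => l /asboolP[D Dl vD] lmax.
exists D; last by apply: vanish_size vD.
move=> v; case: (ordge_step (vD v)) => // ov.
suff /lmax : Q (size (v :: D)) by rewrite /= Dl ltnn.
apply/asboolP; exists (v :: D) => // w; rewrite mult_cons.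
by have [<-|_] := eqVneq v w; rewrite ?add0r // addrC.
Qed.

Lemma binary_forms (J : {mpoly k[n.+1]} -> Prop) e B : ideal_set J ->
  (forall F, iota F = 0 -> J F) -> B \is e.-homog -> iota B != 0 -> J B ->
  has_binary_forms J.
Proof.
move=> iJ JI hB B0 JB a l.
(* The multiples of [B] have codimension [deg * e] in degree [e + D]. With this [D] the [e + D + 1]
   monomials in ['X_l] and ['X_a] are more than that, hence dependent modulo them. *)
pose D := (m0 + deg * e)%N.
have [h dh hE] := @hilb_max D (leq_addr _ _).
pose V := section_space (e + D).
pose U s := exists2 A, A \is D.-homog & s = iota (B * A).
have sU : subspace scal U.
  split; first by exists 0; rewrite ?dhomog0 // mulr0 rmorph0.
  move=> c f g [A1 h1 ->] [A2 h2 ->]; exists (c *: A1 + A2).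
    by rewrite dhomogD // dhomogZ.
  by rewrite mulrDr -scalerAr -mul_mpolyC rmorphD [iota (_%:MP * _)]rmorphM.
pose mon (s : 'I_(e + D).+1) : {mpoly k[n.+1]} := 'X_l ^+ s * 'X_a ^+ (e + D - s).
have hmon r : mon r \is (e + D).-homog.
  have E : (e + D = (1 * r) + (1 * (e + D - r)))%N by rewrite !mul1n subnKC // -ltnS.
  by rewrite [X in X.-homog]E; apply: dhomogM; apply: dhomogMn; apply: var_homog.
have [] := @dim_ge_dependent _ _ scal U V h (e + D).+1 (fun r => iota (mon r)) sU.
- by move=> f [A hA ->]; exists (B * A); rewrite ?dhomogM.
- apply: (dim_ge_mul B0 _ dh) => f [A hA ->]; exists A; rewrite ?rmorphM //.
- by move=> s; exists (mon s).
- have eD : (m0 <= e + D)%N by rewrite /D; lia.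
  by move/(hilb _ eD); rewrite mulnDr; rewrite /D in hE *; lia.
move=> c [A hA cA] [s cs].
pose p := \poly_(s < (e + D).+1) c (inord s).
exists p.
  apply: contra cs => /eqP pE; have := coef_poly (e + D).+1 (fun r => c (inord r)) s.
  by rewrite -/p pE coef0 ltn_ord inord_val => <-.
exists (e + D)%N; first exact: size_poly.
rewrite -[binary_form _ _ _ _](subrK (B * A)); case: (iJ) => _ JD JM.
apply: JD; last by rewrite mulrC; apply: JM.
apply: JI; rewrite rmorphB -cA /binary_form rmorph_sum /lin_comb -sumrB big1 //.
move=> s' _; rewrite coef_poly ltn_ord inord_val -mul_mpolyC rmorphM.
by rewrite /= subrr.
Qed.

Lemma iota_combination e A B L G F : L \is 1.-homog -> G \is 1.-homog ->
  F \is e.+1.-homog -> iota F = iota (A * L + B * G) ->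
  iota F = iota (pihomog mdeg e A * L + pihomog mdeg e B * G).
Proof.
move=> hL hG hF E; apply/eqP; rewrite -subr_eq0 -rmorphB; apply/eqP.
rewrite -(pihomog_dE hF) -(addn1 e) -(pihomogMr _ _ hL) -(pihomogMr _ _ hG).
by rewrite -pihomogD -pihomogB; apply: iota_homog; rewrite rmorphB E subrr.
Qed.

Lemma meval_homog (e : nat) F (c : k) (u u' : 'I_n.+1 -> k) :
  F \is e.-homog -> (forall a, u a = c * u' a) -> F.@[u] = c ^+ e * F.@[u'].
Proof.
move=> /dhomogP hF uE; rewrite !mevalE mulr_sumr big_seq [RHS]big_seq.
apply: eq_bigr => r /hF re; rewrite mulrCA; congr (_ * _).
under eq_bigr do rewrite uE exprMn.
by rewrite big_split prodrXr -mdegE re.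
Qed.

(** A point off the curve is no zero of [J], because a homogeneous component of some element of the
    kernel of [iota] is nonzero there; points of the curve are covered by the last hypothesis. *)
Lemma curve_nullstellensatz (J : {mpoly k[n.+1]} -> Prop) e B : ideal_set J ->
  (forall F, iota F = 0 -> J F) -> B \is e.-homog -> iota B != 0 -> J B ->
  (forall v, exists (b : nat) F, [/\ F \is b.-homog, J F & F.@[co v] != 0]) ->
  exists e0, forall (b : nat) F, (e0 <= b)%N -> F \is b.-homog -> J F.
Proof.
move=> iJ JI hB B0 JB Jv.
apply: (projective_nullstellensatz iJ (binary_forms iJ JI hB B0 JB)) => u [a ua].
have [uI|/existsNP[F /not_implyP[F0 Fu]]] :=
    pselect (forall F, iota F = 0 -> F.@[u] = 0); last first.
  have [b Fb] : exists b, (pihomog mdeg b F).@[u] != 0.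
    apply: contrapT => /forallNP nF; apply: Fu.
    have /pihomog_partitionE -> := leqnn (mmeasure mdeg F).
    by rewrite raddf_sum big1 // => b _; apply: contrapT => /eqP; apply: nF.
  exists b, (pihomog mdeg b F); split=> //; first exact: pihomogP.
  by apply/JI/iota_homog.
have [v [c uE]] := co_complete (ex_intro _ a ua) uI.
have c0 : c != 0 by apply: contra ua => /eqP c0; rewrite uE c0 mul0r.
have [b [F [hF JF Fv]]] := Jv v; exists b, F; split=> //.
by rewrite (meval_homog hF uE) mulf_neq0 ?expf_neq0.
Qed.

(** * Two linear forms without common zeros on the curve *)

Section LinearForms.
Variables (G L : {mpoly k[n.+1]}).
Hypotheses (hG : G \is 1.-homog) (hL : L \is 1.-homog) (G0 : iota G != 0).
Hypothesis noGL : forall v, G.@[co v] = 0 -> L.@[co v] != 0.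

Lemma linear_forms_generate : exists e0 : nat, forall (e : nat) s, (e0 <= e)%N ->
  section_space e.+1 s -> exists s1 s2,
  [/\ section_space e s1, section_space e s2 & s = iota L * s1 + iota G * s2].
Proof.
pose J F := exists A B, iota F = iota (A * L + B * G).
have iJ : ideal_set J.
  split; first by exists 0, 0; rewrite !mul0r addr0.
    move=> F1 F2 [A1 [B1 E1]] [A2 [B2 E2]]; exists (A1 + A2), (B1 + B2).
    by rewrite rmorphD E1 E2 -rmorphD; congr (iota _); ring.
  move=> H F [A1 [B1 E1]]; exists (H * A1), (H * B1).
  by rewrite rmorphM E1 -rmorphM; congr (iota _); ring.
have JI F : iota F = 0 -> J F by exists 0, 0; rewrite !mul0r addr0 rmorph0.
have JG : J G by exists 0, 1; rewrite mul0r add0r mul1r.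
have JL : J L by exists 1, 0; rewrite mul0r addr0 mul1r.
have [v|e0 He0] := curve_nullstellensatz iJ JI hG G0 JG.
  have [Gv|Gv] := eqVneq (G.@[co v]) 0; last by exists 1%N, G.
  by exists 1%N, L; split=> //; apply: noGL.
exists e0 => e s ee [F hF ->]; have [A [B E]] := He0 e.+1 F (leqW ee) hF.
exists (iota (pihomog mdeg e A)), (iota (pihomog mdeg e B)); split.
- by exists (pihomog mdeg e A); rewrite ?pihomogP.
- by exists (pihomog mdeg e B); rewrite ?pihomogP.
by rewrite (iota_combination hL hG hF E) rmorphD !rmorphM mulrC [X in _ + X]mulrC.
Qed.

Lemma mul_subspace (g : K) U : subspace scal U ->
  subspace scal (fun s => exists2 s', U s' & s = g * s').
Proof.
move=> [U0 UD]; split; first by exists 0; rewrite ?mulr0.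
move=> c f f' [s1 U1 ->] [s2 U2 ->]; exists (scal c * s1 + s2); first exact: UD.
by ring.
Qed.

(** In large degree, multiplication by [L] maps the forms of degree [e + 1] modulo [G] onto those of
    degree [e + 2] modulo [G], by [linear_forms_generate]. Both quotients have dimension [deg], so
    the map is injective. *)
Lemma linear_form_regular : exists e0 : nat, forall (e : nat) s, (e0 <= e)%N ->
  section_space e.+1 s ->
  (exists2 s', section_space e.+1 s' & iota L * s = iota G * s') ->
  exists2 s', section_space e s' & s = iota G * s'.
Proof.
have [e1 gen] := linear_forms_generate.
exists (e1 + m0)%N => e s ee Ms [s' Ms' Ls]; apply: contrapT => nU.
have me : (m0 <= e)%N by lia.
have [h dh hE] := hilb_max me.
pose Z f := section_space e.+1 f /\
  exists2 f', section_space e.+1 f' & iota L * f = iota G * f'.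
have [M0 MD] := section_space_subspace e.+1.
have sZ : subspace scal Z.
  split; first by split=> //; exists 0; rewrite ?mulr0.
  move=> c f g [Mf [f' Mf' fE]] [Mg [g' Mg' gE]]; split; first exact: MD.
  exists (scal c * f' + g'); first exact: MD.
  by rewrite !mulrDr mulrCA fE gE; ring.
pose U f := exists2 f', section_space e f' & f = iota G * f'.
have sU : subspace scal U by apply/mul_subspace/section_space_subspace.
have UZ f : U f -> Z f.
  move=> [f' Mf' ->]; split; first by rewrite -(add1n e); apply: section_spaceM.
  exists (iota L * f'); last by ring.
  by rewrite -(add1n e); apply: section_spaceM.
have dU : dim_ge scal U h by apply: (dim_ge_mul G0 _ dh) => f Mf; exists f.
have dZ : dim_ge scal Z h.+1.
  apply: (dim_ge_ext sU UZ (f := s)) => //.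
  by split=> //; exists s'.
have me1 : (m0 <= e.+1)%N by lia.
(* That [Z] is larger than [U] forces [deg] to be positive, so [deg.-1] is a genuine predecessor. *)
have d0 : (0 < deg)%N.
  have /(hilb _ me1) : dim_ge scal (section_space e.+1) h.+1.
    by apply: dim_ge_sub dZ => f [].
  by lia.
have cZ : codim_le scal (section_space e.+1) Z deg.-1.
  apply: (codim_le_dim sZ (section_space_subspace _) _ dZ); first by move=> f [].
  by move/(hilb _ me1); rewrite mulnS; lia.
pose W f := exists2 f', section_space e.+1 f' & f = iota G * f'.
have sW : subspace scal W by apply/mul_subspace/section_space_subspace.
have cW : codim_le scal (section_space e.+2) W deg.-1.
  (* The products by [L] of representatives modulo [Z] represent everything in degree [e + 2] modulo
     [G], with one vector fewer than the Hilbert function requires. *)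
  have [b Hb] := cZ; exists (fun i => iota L * b i) => f Mf.
  have [|s1 [s2 [M1 M2 ->]]] := gen e.+1 f _ Mf; first by lia.
  have [c [_ [f' Mf' cE]]] := Hb s1 M1; exists c.
  exists (s2 + f'); first exact: (subspaceD (section_space_subspace _)).
  by rewrite lin_comb_mul mulrDr -cE; ring.
have me2 : (m0 <= e.+2)%N by lia.
have [h1 dh1 hE1] := hilb_max me1.
have /(dim_ge_codim sW cW) dW : dim_ge scal (section_space e.+2) (h1.+1 + deg.-1).
  by apply/hilb => //; rewrite mulnS; lia.
have /(hilb _ me1) : dim_ge scal (section_space e.+1) h1.+1; last by lia.
apply: (dim_ge_mul (g := (iota G)^-1) _ _ dW); first by rewrite invr_eq0.
by move=> f [f' Mf' ->]; rewrite mulKf.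
Qed.

Lemma linear_form_regularX : exists e0 : nat, forall (b e : nat) s, (e0 <= e)%N ->
  section_space e.+1 s ->
  (exists2 s', section_space (e + b) s' & iota L ^+ b * s = iota G * s') ->
  exists2 s', section_space e s' & s = iota G * s'.
Proof.
have [e0 reg] := linear_form_regular; exists e0; elim=> [|b IHb] e s ee Ms [s' Ms' E].
  by exists s'; [rewrite addn0 in Ms' | rewrite -E expr0 mul1r].
have [|||s1 M1 E1] := reg (e + b)%N (iota L ^+ b * s).
- by lia.
- rewrite -addSn addnC -rmorphXn; apply: section_spaceM => //.
  by rewrite -[b in b.-homog]mul1n; apply: dhomogMn.
- by exists s'; [rewrite addnS in Ms' | rewrite mulrA -exprS].
by apply: (IHb e s ee Ms); exists s1.
Qed.

End LinearForms.

(** * Regular sections of large degree are forms *)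

Definition regular j s := forall v, ordge v j 0 s.

Lemma ratio_homog (e e' m : nat) s F G A : F \is e.-homog -> G \is e'.-homog ->
  iota G != 0 -> (m + e')%N = e -> s = iota F / iota G -> s = iota A ->
  section_space m s.
Proof.
move=> hF hG G0 me sE sA; exists (pihomog mdeg m A); first exact: pihomogP.
have : iota (F - A * G) = 0 by rewrite rmorphB rmorphM -sA sE divfK ?subrr.
move/iota_homog => /(_ e); rewrite pihomogB pihomog_dE // -me pihomogMr //.
by move/eqP; rewrite rmorphB subr_eq0 rmorphM sE => /eqP ->; rewrite mulfK.
Qed.

Lemma ev_ratio v f c : ev v f c -> exists (e : nat) F G,
  [/\ F \is e.-homog, G \is e.-homog, iota G != 0 & f = iota F / iota G].
Proof.
by move=> [e [F [G [hF hG /iota_neq0 G0 fE _]]]]; exists e, F, G.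
Qed.

Lemma regular_ratio v (j : nat) s : ordge v j 0 s -> exists (e : nat) F G,
  [/\ F \is (j + e).-homog, G \is e.-homog, G.@[co v] != 0 & s = iota F / iota G].
Proof.
move=> [h [c [[e [F [G [hF hG G0 hE _]]]] ->]]].
exists e, ('X_(piv v) ^+ j * F), G; split=> //.
  by apply: dhomogM => //; apply: piv_form_homog.
by rewrite hE rmorphM rmorphXn expr0z -exprnP; ring.
Qed.

(** The elements [C] that clear the denominator of [s] form an ideal containing, for every point, a
    denominator that is nonzero there; [curve_nullstellensatz] applies to it. *)
Lemma regular_mul (j : nat) s : regular j s -> exists e0 : nat, forall (e : nat) C,
  (e0 <= e)%N -> C \is e.-homog -> section_space (e + j) (iota C * s).
Proof.
move=> rs; pose J C := exists A, iota C * s = iota A.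
have [b [F0 [B [hF0 hB B0 sE]]]] := regular_ratio (rs p0).
have iJ : ideal_set J.
  split; first by exists 0; rewrite rmorph0 mul0r.
    by move=> C1 C2 [A1 E1] [A2 E2]; exists (A1 + A2); rewrite !rmorphD mulrDl E1 E2.
  by move=> H C [A E]; exists (H * A); rewrite !rmorphM -E mulrA.
have JI C : iota C = 0 -> J C by move=> C0; exists 0; rewrite C0 mul0r rmorph0.
have Jden v : exists e C, [/\ C \is e.-homog, J C & C.@[co v] != 0].
  have [e [F [G [_ hG Gv E]]]] := regular_ratio (rs v).
  exists e, G; split=> //; exists F.
  by rewrite E mulrC divfK // (iota_neq0 Gv).
have JB : J B.
  by exists F0; rewrite sE mulrC divfK // (iota_neq0 B0).
have [e0 He0] := curve_nullstellensatz iJ JI hB (iota_neq0 B0) JB Jden.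
exists e0 => e C ee hC; have [A AE] := He0 e C ee hC.
apply: (ratio_homog (F := C * F0) (G := B) (A := A) _ hB (iota_neq0 B0) erefl) => //.
  by rewrite -addnA; apply: dhomogM.
by rewrite sE rmorphM mulrA.
Qed.

(** The form with coefficients [x ^+ a] takes at [v] the value at [x] of a nonzero polynomial [p v],
    and some [x] is a root of none of these finitely many polynomials. *)
Lemma linear_form_avoiding D :
  exists2 L, L \is 1.-homog & forall v, v \in D -> L.@[co v] != 0.
Proof.
pose p v := \poly_(a < n.+1) co v (inord a).
have p_neq0 v : p v != 0.
  apply/eqP => /(congr1 (fun q : {poly k} => q`_(piv v))).
  by rewrite coef_poly ltn_ord inord_val co_piv coef0 => /eqP; rewrite oner_eq0.
have /closed_nonrootP[x] : \prod_(v <- D) p v != 0.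
  by rewrite prodf_seq_neq0; apply/allP => v _ /=; apply: p_neq0.
rewrite /root horner_prod prodf_seq_neq0 => /allP /= xP.
exists (\sum_(a < n.+1) x ^+ a *: 'X_a).
  apply: rpred_sum => a _; apply: dhomogZ; exact: var_homog.
move=> v /xP; rewrite horner_poly raddf_sum; congr (_ != 0).
by apply: eq_bigr => a _; rewrite inord_val /= mevalZ mevalXU mulrC.
Qed.

Lemma regularM (e : nat) (j : nat) F s : F \is e.-homog -> regular j s ->
  regular (e + j)%N (iota F * s).
Proof.
by move=> hF rs v; rewrite PoszD -[0]addr0; apply: ordgeM => //; apply: ordge_form.
Qed.

(* Projective normality in large degree: modulo a linear form [G], some linear
   form [L] without common zeros with [G] acts injectively in large degree. *)
Lemma regular_section : exists j1 : nat, forall (j : nat) s, (j1 <= j)%N ->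
  regular j s -> section_space j s.
Proof.
pose G : {mpoly k[n.+1]} := 'X_(piv p0).
have hG : G \is 1.-homog by apply: var_homog.
have G0 : iota G != 0 by apply: xcoord_neq0.
have [D oD _] := form_divisor_le hG G0.
have [L hL LD] := linear_form_avoiding D.
have noGL v : G.@[co v] = 0 -> L.@[co v] != 0.
  move=> Gv; apply: LD; have := ordeq_ge_le (oD v) (ordge_form_root hG Gv).
  by rewrite /mult lez_nat -has_count has_pred1.
have [e2 regX] := linear_form_regularX hG hL G0 noGL.
have hX F (e : nat) : F \is 1.-homog -> F ^+ e \is e.-homog.
  by move=> hF; rewrite -[e in e.-homog]mul1n; apply: dhomogMn.
exists e2 => j s ej rs.
(* Powers of [G] are removed one at a time: some [L ^+ f] also turns [G ^+ b * s] into a form, so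
   injectivity of [L] modulo [G] permits dividing the form [G ^+ b.+1 * s] by [G]. *)
suff H (b : nat) : section_space (b + j) (iota G ^+ b * s) -> section_space j s.
  have [e0 /(_ e0 (G ^+ e0) (leqnn _) (hX _ _ hG))] := regular_mul rs.
  by rewrite rmorphXn => /H.
elim: b => [|b IHb]; first by rewrite expr0 mul1r.
move=> Ms; apply: IHb.
have rs' : regular (b + j)%N (iota G ^+ b * s).
  by rewrite -rmorphXn; apply: regularM => //; apply: hX.
have [f /(_ f (L ^+ f) (leqnn _) (hX _ _ hL)) Lf] := regular_mul rs'.
rewrite rmorphXn in Lf.
have [|||s' Ms' /(mulfI G0) ->//] := regX f (b + j)%N (iota G * (iota G ^+ b * s)).
- by rewrite (leq_trans ej) ?leq_addl.
- by rewrite mulrA -exprS -addSn.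
by exists (iota L ^+ f * (iota G ^+ b * s)); [rewrite addnC | ring].
Qed.

(** For the reverse inequality, a section of degree [j + e] vanishing along [D] becomes regular of
    degree [j] when divided by [F], hence is a form. So [D] imposes at least [deg * e]
    conditions. *)
Lemma form_divisor (e : nat) F : F \is e.-homog -> iota F != 0 ->
  exists2 D, forall v, ordeq v e (mult v D) (iota F) & size D = (deg * e)%N.
Proof.
move=> hF F0; have [D oD sD] := form_divisor_le hF F0; exists D => //.
apply/eqP; rewrite eqn_leq sD /=.
have [j1 reg] := regular_section; pose j := (m0 + j1 + genus + size D)%N.
have [h dh hE] : exists2 h, dim_ge scal (section_space (j + e)) (h + size D)
    & (h + size D + genus = deg * (j + e) + 1)%N.
  have [|h dh hE] := @hilb_max (j + e); first by rewrite /j; lia.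
  have [d0|d0] := posnP deg.
    have s0 : size D = 0%N by move: sD; rewrite d0; lia.
    by exists h; rewrite s0 addn0.
  have jd : (j <= deg * j)%N by rewrite leq_pmull.
  have sh : (size D <= h)%N by move: hE; rewrite mulnDr /j in jd *; lia.
  by exists (h - size D)%N; rewrite subnK.
have jm : (m0 <= j)%N by rewrite /j; lia.
suff /(hilb _ jm) : dim_ge scal (section_space j) h.
  by move: hE; rewrite mulnDr; lia.
have := @dim_ge_orders _ (j + e)%N (fun=> 0) D h (section_space_subspace (j + e)) _ dh.
case=> [s [A hA ->] v|]; first exact: ordge_form.
move=> a Va fa; have : dim_ge scal (fun s => section_space (j + e) s /\
  forall v, ordge v (j + e)%N (0 + mult v D) s) h by exists a.
apply: (dim_ge_mul (g := (iota F)^-1)); first by rewrite invr_eq0.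
move=> s [_ os]; apply: reg => [|v]; first by rewrite /j; lia.
have := ordgeM (ordeq_ge (ordeqV (oD v))) (os v).
by rewrite add0r addNr PoszD addrC addrK.
Qed.

(** * Divisors of functions and Riemann-Roch spaces *)

Definition ratio s := exists (e : nat) F G,
  [/\ F \is e.-homog, G \is e.-homog, iota G != 0 & s = iota F / iota G].

Lemma ratioM s s' : ratio s -> ratio s' -> ratio (s * s').
Proof.
move=> [e [F [G [hF hG G0 ->]]]] [e' [F' [G' [hF' hG' G0' ->]]]].
exists (e + e')%N, (F * F'), (G * G'); split; rewrite ?dhomogM //.
  by rewrite rmorphM mulf_neq0.
by rewrite mulf_div !rmorphM.
Qed.

Lemma ratioV s : s != 0 -> ratio s -> ratio s^-1.
Proof.
move=> + [e [F [G [hF hG G0 sE]]]]; rewrite sE mulf_eq0 negb_or => /andP[F0 _].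
by exists e, G, F; split=> //; rewrite invf_div.
Qed.

Lemma ratioX s (e : int) : s != 0 -> ratio s -> ratio (s ^ e).
Proof.
move=> s0 rs; have rX (b : nat) : ratio (s ^+ b).
  elim: b => [|b IHb]; last by rewrite exprS; apply: ratioM.
  exists 0%N, 1, 1; rewrite expr0 rmorph1 oner_eq0 divr1; split=> //; exact: dhomog1.
case: e => b; first exact: rX.
by rewrite NegzE -exprnN -exprVn exprVn; apply: ratioV; rewrite ?expf_neq0.
Qed.

Lemma ordge_ratio v (m : int) s : ordge v 0 m s -> ratio s.
Proof.
move=> [h [c [hc ->]]]; rewrite expr0z mulr1; apply: ratioM.
  exact: ev_ratio hc.
by apply: ratioX => //; apply: ev_ratio (t_max v).
Qed.

(** Numerator and denominator are forms of one degree, so their divisors have the same size: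
    principal divisors have degree 0. *)
Lemma function_divisor s : s != 0 -> ratio s -> exists D1 D2, size D1 = size D2 /\
  forall v, ordeq v 0 (mult v D1 - mult v D2) s.
Proof.
move=> + [e [F [G [hF hG G0 sE]]]]; rewrite sE mulf_eq0 negb_or => /andP[F0 _].
have [D1 o1 s1] := form_divisor hF F0; have [D2 o2 s2] := form_divisor hG G0.
exists D1, D2; split; first by rewrite s1 s2.
by move=> v; have := ordeqM (o1 v) (ordeqV (o2 v)); rewrite subrr.
Qed.

Lemma mult_leq_cat D1 D2 : (forall v, mult v D2 <= mult v D1) ->
  exists E, forall v, mult v D1 = mult v D2 + mult v E.
Proof.
elim: D2 D1 => [|w D2 IH] D1 le21; first by exists D1 => v; rewrite add0r.
have wD1 : w \in D1.
  have := le21 w; rewrite mult_cons eqxx /mult -PoszD lez_nat => le.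
  by rewrite -has_pred1 has_count (leq_trans _ le).
have E v : mult v D1 = (w == v)%:Z + mult v (rem w D1).
  by rewrite -mult_cons /mult; congr (Posz _); apply/permP/perm_to_rem.
have [|C HC] := IH (rem w D1).
  by move=> v; have := le21 v; rewrite mult_cons E lerD2l.
by exists C => v; rewrite E mult_cons HC addrA.
Qed.

Lemma mult_cat v D1 D2 : mult v (D1 ++ D2) = mult v D1 + mult v D2.
Proof. by rewrite /mult count_cat PoszD. Qed.

Lemma eq_mult_size D1 D2 : (forall v, mult v D1 = mult v D2) -> size D1 = size D2.
Proof.
move=> E; apply: perm_size; apply/allP => v _ /=.
by apply/eqP; have := E v; rewrite /mult => -[].
Qed.

Definition Riemann_Roch_space D s := forall v, ordge v 0 (- mult v D) s.

Lemma Riemann_Roch_space_subspace D : subspace scal (Riemann_Roch_space D).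
Proof. exact: subspace_orders. Qed.

(* Once [L(D)] is large it meets [O(m)] twisted down, so that [D] is equivalent
   to the hyperplane section [m H] plus an effective divisor [E]. *)
Lemma Riemann_inequality : exists l0 : nat, forall D l, (l0 <= l)%N ->
  dim_ge scal (Riemann_Roch_space D) l -> (l + genus <= size D + 1)%N.
Proof.
have [j1 reg] := regular_section; pose m := (m0 + j1)%N.
have [G hG G0] : exists2 G, G \is m.-homog & iota G != 0.
  exists ('X_(piv p0) ^+ m); first exact: piv_form_homog.
  by rewrite rmorphXn expf_neq0 // xcoord_neq0.
have [DG oG sG] := form_divisor hG G0.
(* This threshold leaves at least one dimension of [L(D)] after the zeros [DG] of a form of degree
   [m] are imposed, hence a nonzero [z]. *)
exists (size DG).+1 => D l ll dl; have sL := Riemann_Roch_space_subspace D.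
have lE : (l = (l - size DG) + size DG)%N by rewrite subnK // ltnW.
have [z [Lz oz] z0] : exists2 z, Riemann_Roch_space D z /\
    (forall v, ordge v 0 (- mult v D + mult v DG) z) & z != 0.
  have := dl; rewrite lE => /(dim_ge_orders sL (fun s Ls => Ls)).
  have l1 : (1 <= l - size DG)%N by rewrite subn_gt0.
  move/(dim_ge_leq l1) => [e Ve fe]; exists (e ord0); first exact: Ve.
  apply/eqP => e0; have := fe (fun=> 1); rewrite /lin_comb big_ord1 e0 mulr0.
  by move/(_ erefl ord0)/eqP; rewrite oner_eq0.
have [D1 [D2 [s12 o12]]] := function_divisor z0 (ordge_ratio (Lz p0)).
(* The divisor of [z] is [DG + E - D], so [D] is equivalent to [DG + E]. *)
have [E HE] : exists E, forall v, mult v (D ++ D1) = mult v (DG ++ D2) + mult v E.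
  apply: mult_leq_cat => v; rewrite !mult_cat.
  by have := ordeq_ge_le (o12 v) (oz v); lia.
have sE : (size D = deg * m + size E)%N.
  have : size (D ++ D1) = size ((DG ++ D2) ++ E).
    by apply: eq_mult_size => v; rewrite HE [RHS]mult_cat.
  by rewrite !size_cat sG s12; lia.
have [lE'|El] := leqP l (size E).
  have [h _ hE] := @hilb_max m (leq_addr _ _).
  rewrite sE; lia.
have mm : (m0 <= m)%N by apply: leq_addr.
suff /(hilb _ mm) : dim_ge scal (section_space m) (l - size E) by rewrite sE; lia.
have := dl; rewrite -(subnK (ltnW El)) => /(dim_ge_orders sL (fun s Ls => Ls)).
rewrite addnK.
(* [iota G / z] has divisor [D - E], so it carries [L(D - E)] to regular sections of degree [m]. *)
apply: (dim_ge_mul (g := iota G / z)); first by rewrite mulf_neq0 ?invr_eq0.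
move=> f [_ of_]; apply: reg => [|v]; first exact: leq_addl.
have := ordgeM (ordeq_ge (ordeqM (oG v) (ordeqV (o12 v)))) (of_ v).
rewrite subr0 addr0; apply: ordgeW.
by have := HE v; rewrite !mult_cat; lia.
Qed.

Lemma ordgeM0 v (m m' : int) s s' : ordge v 0 m s -> ordge v 0 m' s' ->
  ordge v 0 (m + m') (s * s').
Proof. by move=> os os'; have := ordgeM os os'; rewrite addr0. Qed.

Lemma ordeqM0 v (m m' : int) s s' : ordeq v 0 m s -> ordeq v 0 m' s' ->
  ordeq v 0 (m + m') (s * s').
Proof. by move=> os os'; have := ordeqM os os'; rewrite addr0. Qed.

Lemma ordge_scal v c : ordge v 0 0 (scal c).
Proof. by exists (scal c), c; split; [exact: ev_scal | rewrite !expr0z !mulr1]. Qed.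

Lemma ordeq_scal v c : c != 0 -> ordeq v 0 0 (scal c).
Proof.
by move=> c0; exists (scal c), c; split=> //; [exact: ev_scal | rewrite !expr0z !mulr1].
Qed.

Lemma ordgeX v (m : int) s (e : nat) : ordge v 0 m s -> ordge v 0 (m * e%:Z) (s ^+ e).
Proof.
move=> os; elim: e => [|e IHe].
  by rewrite mulr0 expr0 -(rmorph1 scal); apply: ordge_scal.
by rewrite exprS intS mulrDr mulr1; apply: ordgeM0.
Qed.

Lemma ordeqXz v (m e : int) s : ordeq v 0 m s -> ordeq v 0 (m * e) (s ^ e).
Proof.
case: e => e os; first exact: ordeqX.
have := ordeqV (ordeqX e.+1 os); rewrite oppr0 NegzE mulrN.
by rewrite exprnN.
Qed.

Lemma ordgeD v j (m : int) s s' : ordge v j m s -> ordge v j m s' -> ordge v j m (s + s').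
Proof. exact: (subspaceD (ordge_subspace v j m)). Qed.

Lemma ordgeZ v j (m : int) c s : ordge v j m s -> ordge v j m (scal c * s).
Proof. exact: (subspaceZ c (ordge_subspace v j m)). Qed.

Lemma ordgeB v j (m : int) s s' : ordge v j m s -> ordge v j m s' -> ordge v j m (s - s').
Proof. exact: (subspaceB (ordge_subspace v j m)). Qed.

Lemma ordgeN v j (m : int) s : ordge v j m s -> ordge v j m (- s).
Proof.
move=> os; rewrite -sub0r; apply: ordgeB => //.
by have [] := ordge_subspace v j m.
Qed.

Lemma ordge_sum v j (m : int) (I : finType) (A : pred I) (F : I -> K) :
  (forall i, A i -> ordge v j m (F i)) -> ordge v j m (\sum_(i | A i) F i).
Proof.
move=> oF; apply: (big_ind (ordge v j m)) => //; last exact: ordgeD.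
by have [] := ordge_subspace v j m.
Qed.

Lemma ordeqD v j (m : int) s s' : ordeq v j m s -> ordge v j (m + 1) s' ->
  ordeq v j m (s + s').
Proof.
move=> [h [c [hc c0 ->]]] [h' [c' [hc' ->]]].
exists (h + h' * t v), c; split=> //.
  by have := evD hc (evM hc' (t_max v)); rewrite mulr0 addr0.
by rewrite expfzDr // expr1z; ring.
Qed.

Lemma ordge_or_eq v j (m : int) s (d : nat) : ordge v j m s ->
  ordge v j (m + d%:Z) s \/ exists2 e : nat, (e < d)%N & ordeq v j (m + e%:Z) s.
Proof.
move=> os; elim: d => [|d [od|[e ed oe]]]; first by left; rewrite addr0.
  case: (ordge_step od) => o; first by right; exists d.
  by left; rewrite intS [1 + _]addrC addrA.
by right; exists e => //; apply: leq_trans ed _.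
Qed.

(** A term of least order cannot be cancelled by the others, all of larger order; so there is no
    term at all. *)
Lemma distinct_orders v j (I : finType) (A : pred I) (F : I -> K) (o : I -> int) :
  (forall i, A i -> ordeq v j (o i) (F i)) ->
  {in A &, injective o} -> \sum_(i | A i) F i = 0 -> forall i, ~~ A i.
Proof.
move=> oF oi F0 i0; apply/negP => Ai0.
case: (arg_minP o Ai0) => i Ai imin.
have : ordge v j (o i + 1) (\sum_(i' | A i' && (i' != i)) F i').
  apply: ordge_sum => i' /andP[Ai' ii']; apply: (ordgeW _ (ordeq_ge (oF _ Ai'))).
  rewrite lezD1 lt_neqAle imin // andbT.
  by apply: contra ii' => /eqP /oi -> //.
move: F0; rewrite (bigD1 i) //= => /eqP; rewrite addrC addr_eq0 => /eqP -> /ordgeN.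
by rewrite opprK; apply: ordeq_geN; apply: oF.
Qed.

(** The divisor of a nonzero such [s] would be effective of degree 0, hence zero, and could not
    contain [v]. *)
Lemma regular_root v s : regular 0 s -> ordge v 0 1 s -> s = 0.
Proof.
move=> rs ov; apply/eqP; apply: contrapT => /negP s0.
have [D1 [D2 [s12 o12]]] := function_divisor s0 (ordge_ratio ov).
have [|E HE] := @mult_leq_cat D1 D2.
  by move=> w; have := ordeq_ge_le (o12 w) (rs w); lia.
have : size D1 = size (D2 ++ E) by apply: eq_mult_size => w; rewrite mult_cat.
rewrite size_cat s12 -[X in X = _]addn0 => /addnI/esym/size0nil E0.
by have := ordeq_ge_le (o12 v) ov; rewrite HE E0 /mult /=; lia.
Qed.

(** * Polynomials in a function and their orders *)

Definition pval (p : {poly k}) (x : K) := (map_poly scal p).[x].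

Lemma pvalE p x : pval p x = \sum_(i < size p) scal p`_i * x ^+ i.
Proof.
by rewrite /pval horner_coef size_map_poly; apply: eq_bigr => i _; rewrite coef_map.
Qed.

Lemma pvalD p q x : pval (p + q) x = pval p x + pval q x.
Proof. by rewrite /pval rmorphD hornerD. Qed.

Lemma pvalCX c (i : nat) x : pval (c *: 'X^i) x = scal c * x ^+ i.
Proof. by rewrite /pval map_polyZ map_polyXn hornerZ hornerXn. Qed.

Lemma pvalC c x : pval c%:P x = scal c.
Proof. by rewrite /pval map_polyC hornerC. Qed.

Lemma ordge_pval v p x : ordge v 0 0 x -> ordge v 0 0 (pval p x).
Proof.
move=> ox; rewrite pvalE; apply: ordge_sum => i _.
by apply: ordgeZ; have := ordgeX i ox; rewrite mul0r.
Qed.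

Lemma ordge_pval_pole v (a N : nat) (p : {poly k}) x :
  ordge v 0 (- a%:Z) x -> (size p <= N.+1)%N ->
  ordge v 0 (- (a * N)%N%:Z) (pval p x).
Proof.
move=> ox sp; rewrite pvalE; apply: ordge_sum => i _.
apply: ordgeZ; apply: ordgeW (ordgeX i ox); rewrite mulNr lerN2 -PoszM lez_nat leq_mul2l.
by rewrite -ltnS (leq_trans _ sp) ?orbT.
Qed.

Lemma ordeq_pval v (a : nat) (p : {poly k}) x :
  (0 < a)%N -> ordeq v 0 (- a%:Z) x -> p != 0 ->
  ordeq v 0 (- (a * (size p).-1)%N%:Z) (pval p x).
Proof.
move=> a0 ox p_neq0; rewrite pvalE -(@prednK (size p)) ?size_poly_gt0 //.
rewrite big_ord_recr /= addrC; apply: ordeqD.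
  rewrite -[- _]add0r PoszM -mulNr; apply: ordeqM0; last exact: ordeqX.
  by apply: ordeq_scal; rewrite -lead_coefE lead_coef_eq0.
apply: ordge_sum => i _; apply: ordgeZ; apply: ordgeW (ordgeX i (ordeq_ge ox)).
have : (a * i.+1 <= a * (size p).-1)%N by rewrite leq_mul2l ltn_ord orbT.
by rewrite mulnS; move: (nat_of_ord i) => i'; move: (size p).-1 => d; lia.
Qed.

(* Subtracting powers of [x] lowers the pole order of [f] at [v] until it is no
   longer divisible by [a]. *)
Lemma polar_reduction v (a N : nat) x f : (0 < a)%N -> ordeq v 0 (- a%:Z) x ->
  (forall w, w != v -> ordge w 0 0 x) -> (forall w, w != v -> ordge w 0 0 f) ->
  ordge v 0 (- N%:Z) f ->
  exists p, f = pval p x \/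
    exists2 e : nat, ~~ (a %| e)%N & ordeq v 0 (- e%:Z) (f - pval p x).
Proof.
move=> a0 ox xv; elim: N f => [|N IHN] f fv of_.
  (* With no pole left, [f] minus its value at [v] is regular and vanishes at [v], hence is zero by
     [regular_root]. *)
  have [h [c [hc]]] := of_; rewrite !expr0z !mulr1 => fh; exists c%:P; left.
  rewrite pvalC; apply/eqP; rewrite -subr_eq0; apply/eqP.
  apply: (@regular_root v).
    move=> w; apply: ordgeB; last exact: ordge_scal.
    by have [->|/fv//] := eqVneq w v.
  have : ev v (h - scal c) 0.
    by have := evD hc (ev_scal v (- c)); rewrite rmorphN subrr.
  rewrite -fh => /t_gen[h' [c' [hc' E]]].
  by exists h', c'; split=> //; rewrite expr0z mulr1 expr1z.
have [e1|o] := ordge_step of_; last first.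
  by apply: IHN => //; move: o; congr (ordge _ _ _ _); lia.
have [aN|aN] := boolP (a %| N.+1)%N; last first.
  exists 0; right; exists N.+1 => //.
  by rewrite (_ : pval 0 x = 0) ?subr0 // /pval rmorph0 horner0.
have [i Ni] := dvdnP aN.
have oxi : ordeq v 0 (- N.+1%:Z) (x ^+ i).
  by rewrite Ni mulnC PoszM -mulNr; apply: ordeqX.
have [o|[c o]] := ordge_codim (ordeq_ge oxi) of_.
  by case: (ordeq_geN oxi).
have [||p Hp] := IHN (f - scal c * x ^+ i).
- move=> w wv; apply: ordgeB; first exact: fv.
  by apply: ordgeZ; have := ordgeX i (xv w wv); rewrite mul0r.
- by move: o; congr (ordge _ _ _ _); lia.
exists (c *: 'X^i + p); rewrite pvalD pvalCX; case: Hp => [E|[e ae oe]]; [left|right].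
  by rewrite -E addrC subrK.
by exists e => //; rewrite opprD addrA.
Qed.

(** At [v] a nonzero [j]-th term has order congruent to [- e * j] modulo [a]. As the prime [a] does
    not divide [e], these residues differ for [j < a], and [distinct_orders] applies. *)
Lemma independent_of_orders v (a e : nat) x y : prime a -> ordeq v 0 (- a%:Z) x ->
  ~~ (a %| e)%N -> ordeq v 0 (- e%:Z) y ->
  forall q : {poly {poly k}}, (size q <= a)%N ->
  \sum_(j < a) pval q`_j x * y ^+ j = 0 -> q = 0.
Proof.
move=> pa ox ae ow q sq q0.
have a0 := prime_gt0 pa.
pose A (j : 'I_a) := q`_j != 0.
pose dg (j : 'I_a) := (size q`_j).-1.
pose o (j : 'I_a) : int := - (a * dg j)%N%:Z + - e%:Z * j%:Z.
have {q0} : \sum_(j < a | A j) pval q`_j x * y ^+ j = 0.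
  rewrite -[RHS]q0 [RHS](bigID A) /= [X in _ = _ + X]big1 ?addr0 // => j /negbNE /eqP ->.
  by rewrite /pval rmorph0 horner0 mul0r.
move/(distinct_orders (v := v) (j := 0) (o := o)) => H.
apply/polyP => j; rewrite coef0.
have [ja|ja] := ltnP j a; last by rewrite nth_default // (leq_trans sq).
apply/eqP; rewrite -[_ == 0]negbK; apply: (H _ _ (Ordinal ja)).
  by move=> i Ai; apply: ordeqM0; [apply: ordeq_pval | apply: ordeqX].
move=> i1 i2 _ _ oE; apply/val_inj => /=.
wlog le12 : i1 i2 oE / (i1 <= i2)%N.
  by move=> W; have [/W->//|/ltnW/W->] := leqP i1 i2.
have : (a %| e * (i2 - i1))%N.
  have E : (a * dg i1 + e * i1 = a * dg i2 + e * i2)%N.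
    by move: oE; rewrite /o; move: (dg i1) (dg i2) => d1 d2; lia.
  rewrite mulnBr; have -> : (e * i2 - e * i1 = a * dg i1 - a * dg i2)%N.
    by move: E; move: (dg i1) (dg i2) => d1 d2; lia.
  by rewrite -mulnBr dvdn_mulr.
rewrite Euclid_dvdM // (negPf ae) /= => /dvdn_leq.
have := ltn_ord i2; case: posnP => [|_ i2a /(_ isT)]; first by lia.
by lia.
Qed.

Lemma ordeq_uniq v j (m m' : int) s : ordeq v j m s -> ordeq v j m' s -> m = m'.
Proof.
move=> o o'; apply/eqP; rewrite eq_le.
by rewrite (ordeq_ge_le o (ordeq_ge o')) (ordeq_ge_le o' (ordeq_ge o)).
Qed.

Lemma mult_nseq v w (e : nat) : mult v (nseq e w) = (w == v)%:Z * e%:Z.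
Proof. by rewrite /mult count_nseq PoszM. Qed.

(** The inner variable goes to [x] and the outer one to [y], so that composition in the outer
    variable becomes substitution for [y]. *)
Definition bival x : {poly {poly k}} -> K -> K :=
  fun q y => (map_poly (horner_eval x \o map_poly scal) q).[y].

Lemma bivalE (N : nat) x (q : {poly {poly k}}) y : (size q <= N)%N ->
  bival x q y = \sum_(j < N) pval q`_j x * y ^+ j.
Proof.
move=> sq; rewrite /bival (horner_coef_wide _ (leq_trans (size_poly _ _) sq)).
by apply: eq_bigr => i _; rewrite coef_map.
Qed.

Lemma bival_comp x (q r : {poly {poly k}}) y : bival x (q \Po r) y = bival x q (bival x r y).
Proof. by rewrite /bival map_comp_poly horner_comp. Qed.

Lemma pval_poly (N : nat) (c : nat -> k) x :
  pval (\poly_(i < N) c i) x = \sum_(i < N) scal (c i) * x ^+ i.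
Proof.
rewrite poly_def /pval rmorph_sum horner_sum; apply: eq_bigr => i _.
exact: pvalCX.
Qed.

Lemma pvalM p q x : pval (p * q) x = pval p x * pval q x.
Proof. by rewrite /pval rmorphM hornerM. Qed.

Lemma pvalXn (i : nat) x : pval 'X^i x = x ^+ i.
Proof. by rewrite /pval map_polyXn hornerXn. Qed.

Definition polar v (e : nat) s :=
  ordeq v 0 (- e%:Z) s /\ forall w, w != v -> ordge w 0 0 s.

Lemma regular_powers v (i : nat) s : ordge v 0 0 s -> ordge v 0 0 (s ^+ i).
Proof. by move/(ordgeX i); rewrite mul0r. Qed.

(** * Two points with equal gaps *)

Section TwoPoints.
Variables (P Q : pt) (a : nat).
Hypotheses (PQ : P != Q) (a_prime : prime a).

Let a_gt0 : (0 < a)%N := prime_gt0 a_prime.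

(** The [a * (l0 + 1)] monomials [x ^+ i * u ^+ j] are independent in the space of a divisor of
    degree [a * l0 + a * (a - 1)]. The terms in [l0] cancel, leaving [genus] at most the square of
    [a - 1]. *)
Lemma genus_le_independent x u : polar P a x -> polar Q a u ->
  (forall q : {poly {poly k}}, (size q <= a)%N -> bival x q u = 0 -> q = 0) ->
  (genus + a <= a * (a - 1) + 1)%N.
Proof.
move=> [xP xr] [uQ ur] ind; have [l0 RR] := Riemann_inequality.
pose D := nseq (a * l0) P ++ nseq (a * (a - 1)) Q.
suff /RR : dim_ge scal (Riemann_Roch_space D) (l0.+1 * a).
  by rewrite size_cat !size_nseq; move: a_gt0; nia.
have -> : (l0.+1 * a)%N = #|{: 'I_l0.+1 * 'I_a}| by rewrite card_prod !card_ord.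
apply: (dim_ge_fin (e := fun r : 'I_l0.+1 * 'I_a => x ^+ r.1 * u ^+ r.2)).
  move=> [i j] v /=; rewrite mult_cat !mult_nseq.
  have ja : (j <= a - 1)%N by rewrite subn1 -ltnS prednK.
  have il : (i <= l0)%N by rewrite -ltnS.
  have [vP|vP] := eqVneq P v; first (rewrite -vP [Q == P]eq_sym (negPf PQ)).
    apply: ordgeW (ordgeM0 (ordgeX i (ordeq_ge xP)) (regular_powers j (ur _ PQ))).
    by nia.
  have [vQ|vQ] := eqVneq Q v; first rewrite -vQ.
    have := ordgeM0 (regular_powers i (xr Q _)) (ordgeX j (ordeq_ge uQ)).
    rewrite eq_sym => /(_ PQ); apply: ordgeW.
    by nia.
  rewrite !mul0r addr0 oppr0; have := ordgeM0 (regular_powers i (xr v _))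
    (regular_powers j (ur v _)).
  by rewrite addr0; apply; rewrite eq_sym.
move=> c c0.
pose cc (i j : nat) := if (insub i : option 'I_l0.+1) is Some i' then
  if (insub j : option 'I_a) is Some j' then c (i', j') else 0 else 0.
have ccE (i : 'I_l0.+1) (j : 'I_a) : cc i j = c (i, j) by rewrite /cc !valK.
pose q := \poly_(j < a) \poly_(i < l0.+1) cc i j.
have q0 : q = 0.
  apply: ind; first exact: size_poly.
  rewrite (bivalE _ _ (size_poly _ _)) -[RHS]c0.
  transitivity (\sum_(i < l0.+1) \sum_(j < a) scal (c (i, j)) * (x ^+ i * u ^+ j)).
    rewrite exchange_big; apply: eq_bigr => j _.
    rewrite coef_poly ltn_ord pval_poly mulr_suml.
    by apply: eq_bigr => i _; rewrite ccE mulrA.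
  by rewrite pair_bigA; apply: eq_bigr => -[i j].
move=> [i j]; rewrite -ccE.
have := congr1 (fun r : {poly {poly k}} => r`_j`_i) q0.
by rewrite /q !coef_poly !ltn_ord coef_poly ltn_ord !coef0.
Qed.

(** Subtracting the value at [Q] leaves the pole at [P] unchanged. *)
Lemma polar_root x0 : polar P a x0 -> exists2 x, polar P a x & ordge Q 0 1 x.
Proof.
move=> [xP xr]; have QP : Q != P by rewrite eq_sym.
have [h [c [hc]]] := xr Q QP; rewrite !expr0z !mulr1 => xh.
exists (x0 + scal (- c)); first split.
- apply: ordeqD => //; apply: ordgeW (ordge_scal _ _).
  by move: a_gt0; lia.
- by move=> w wP; apply: ordgeD; [apply: xr | apply: ordge_scal].
have : ev Q (h + scal (- c)) 0 by have := evD hc (ev_scal Q (- c)); rewrite subrr.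
rewrite -xh => /t_gen[h' [c' [hc' ->]]].
by exists h', c'; split=> //; rewrite expr0z mulr1 expr1z.
Qed.

Lemma ordeq_pval_root v x (p : {poly k}) : ordge v 0 1 x -> p.[0] != 0 ->
  ordeq v 0 0 (pval p x).
Proof.
move=> xv p_root; have : root (p - (p.[0])%:P) 0 by rewrite /root hornerD hornerN hornerC subrr.
move=> /factor_theorem[r]; rewrite subr0 => /eqP; rewrite subr_eq => /eqP ->.
rewrite pvalD pvalC addrC; apply: ordeqD; first exact: ordeq_scal.
rewrite pvalM -['X]expr1 pvalXn expr1 -[0 + 1]add0r.
apply: ordgeM0; last exact: xv.
by apply: ordge_pval; apply: ordgeW xv.
Qed.

(** As [x ^+ a * u] and [y] differ by a polynomial in [x], a relation for [u] becomes one of no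
    larger degree for [y], to which [independent_of_orders] applies at [P]. *)
Lemma independent_affine x u y (p : {poly k}) (e : nat) : x != 0 ->
  polar P a x -> x ^+ a * u = pval p x + y -> ~~ (a %| e)%N -> ordeq P 0 (- e%:Z) y ->
  forall q : {poly {poly k}}, (size q <= a)%N -> bival x q u = 0 -> q = 0.
Proof.
move=> x0 [xP xr] fE ae ow q sq q0.
(* These powers of ['X] absorb the denominators: [q'] at [x ^+ a * u] is [x ^+ (a * (a - 1))] times
   [q] at [u]. *)
pose q' := \poly_(j < a) (q`_j * 'X^(a * (a - 1 - j))).
have sG : size (q' \Po ('X + p%:P)) = size q' by apply: size_comp_poly2; apply: size_XaddC.
have G0 : q' \Po ('X + p%:P) = 0.
  apply: (independent_of_orders (v := P) (x := x) (y := y) a_prime xP ae ow).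
    by rewrite sG size_poly.
  rewrite -bivalE ?sG ?size_poly // bival_comp.
  have -> : bival x ('X + p%:P) y = x ^+ a * u.
    by rewrite /bival rmorphD /= map_polyX map_polyC hornerD hornerX hornerC fE addrC.
  rewrite (bivalE _ _ (size_poly _ _)).
  transitivity (x ^+ (a * (a - 1)) * bival x q u); last by rewrite q0 mulr0.
  rewrite (bivalE _ _ sq) mulr_sumr; apply: eq_bigr => j _.
  rewrite coef_poly ltn_ord pvalM pvalXn exprMn -exprM.
  have -> : (a * (a - 1) = a * (a - 1 - j) + a * j)%N.
    by rewrite -mulnDr subnK // subn1 -ltnS prednK.
  by rewrite exprD; ring.
have q'0 : q' = 0 by apply/eqP; rewrite -size_poly_eq0 -sG G0 size_poly0.
apply/polyP => j; rewrite coef0; have [ja|ja] := ltnP j a; last first.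
  by rewrite nth_default // (leq_trans sq).
have := congr1 (fun r : {poly {poly k}} => r`_j) q'0.
rewrite coef_poly ja coef0 => /eqP; rewrite mulf_eq0 => /orP[/eqP//|].
by rewrite expf_eq0 polyX_eq0 andbF.
Qed.

(* The first alternative is Castelnuovo's bound for two independent pencils. *)
Lemma pencils_independent_or_equal x0 u : polar P a x0 -> polar Q a u ->
  (genus + a <= a * (a - 1) + 1)%N \/
  exists x, [/\ ordeq P 0 (- a%:Z) x, ordeq Q 0 a x
    & forall v, v != P -> v != Q -> ordeq v 0 0 x].
Proof.
move=> /polar_root[x px xQ] pu; have [xP xr] := px; have [uQ ur] := pu.
have QP : Q != P by rewrite eq_sym.
have x_neq0 := ordeq_neq0 xP; have u_neq0 := ordeq_neq0 uQ.
(* Since [x] vanishes at [Q], the factor [x ^+ a] removes the pole of [u], and the product has poles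
   only at [P]. *)
have [||p [fE|[e ae oe]]] := @polar_reduction P a (a * a) x (x ^+ a * u) a_gt0 xP xr.
- move=> w wP; have [->|wQ] := eqVneq w Q.
    have := ordgeM0 (ordgeX a xQ) (ordeq_ge uQ).
    by rewrite mul1r subrr.
  by have := ordgeM0 (regular_powers a (xr w wP)) (ur w wQ); rewrite addr0.
- have := ordgeM0 (ordgeX a (ordeq_ge xP)) (ur P PQ).
  by rewrite addr0 mulNr PoszM.
- right; exists x; have p_neq0 : p != 0.
    apply: contraTneq (mulf_neq0 (expf_neq0 a x_neq0) u_neq0) => p0E.
    by rewrite fE p0E /pval rmorph0 horner0 eqxx.
  have [m [p1 + pE]] := multiplicity_XsubC p 0; rewrite p_neq0 => /= p1r.
  rewrite subr0 in pE.
  have fE1 : x ^+ a * u = pval p1 x * x ^+ m by rewrite fE pE pvalM pvalXn.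
  (* For [m >= a] the function [u] would be a polynomial in [x], hence regular at [Q]. *)
  have ma : (m < a)%N.
    rewrite ltnNge; apply/negP => am.
    have uE : u = pval p1 x * x ^+ (m - a).
      apply: (mulfI (expf_neq0 a x_neq0)); rewrite fE1 -{1}(subnK am) exprD; ring.
    have : ordge Q 0 0 u.
      rewrite uE; have := ordgeM0 (ordge_pval p1 (xr Q QP)) (regular_powers (m - a) (xr Q QP)).
      by rewrite addr0.
    by move/(ordeq_ge_le uQ); move: a_gt0; lia.
  have uE : u * x ^+ (a - m) = pval p1 x.
    apply: (mulIf (expf_neq0 m x_neq0)); rewrite -fE1 -{2}(subnK (ltnW ma)) exprD; ring.
  (* At a further zero of [x], the product [u * x ^+ (a - m)] would vanish whereas [pval p1 x] takes
     the nonzero value [p1.[0]]. *)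
  have xv v : v != P -> v != Q -> ordeq v 0 0 x.
    move=> vP vQ; have [//|xv1] := ordge_step (xr v vP); rewrite add0r in xv1.
    have := ordgeM0 (ur v vQ) (ordgeX (a - m) xv1).
    by rewrite uE => /(ordeq_ge_le (ordeq_pval_root xv1 p1r)); lia.
  (* Now [Q] is the only zero of [x], and degree 0 gives it multiplicity [a]. *)
  have [D1 [D2 [s12 o12]]] := function_divisor x_neq0 (ordge_ratio xQ).
  pose mu := mult Q D1 - mult Q D2.
  have mu0 : 0 <= mu by have := ordeq_ge_le (o12 Q) xQ; rewrite /mu; lia.
  have : size (D1 ++ nseq a P) = size (D2 ++ nseq `|mu|%N Q).
    apply: eq_mult_size => v; rewrite !mult_cat !mult_nseq gez0_abs //.
    have [vP|vP] := eqVneq P v.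
      rewrite -vP (negPf QP); have := ordeq_uniq (o12 P) xP; lia.
    have [vQ|vQ] := eqVneq Q v; first by rewrite -vQ /mu; lia.
    by have := ordeq_uniq (o12 v) (xv v _ _); rewrite ![v == _]eq_sym; lia.
  rewrite !size_cat !size_nseq s12 => /addnI aE.
  split=> //; have := o12 Q; rewrite -/mu -[mu]gez0_abs // -aE; exact: id.
left; apply: (genus_le_independent px pu).
apply: (independent_affine (p := p) x_neq0 px _ ae oe).
by rewrite addrC subrK.
Qed.

(** * Two points with a common pencil *)

Section EqualPencils.
Variable x : K.
Hypotheses (xP : ordeq P 0 (- a%:Z) x) (xQ : ordeq Q 0 a x).
Hypothesis x_unit : forall v, v != P -> v != Q -> ordeq v 0 0 x.

(** The counterpart of [polar_reduction] at a zero: [x ^+ N] has order [a * N] at [Q], so a multiple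
    of it can raise any order of this form. *)
Lemma zero_reduction (N : nat) f : ordge Q 0 0 f ->
  exists p : {poly k}, (size p <= N)%N /\ (ordge Q 0 (a * N)%N (f - pval p x) \/
    exists2 s : nat, (s < a * N)%N /\ ~~ (a %| s)%N & ordeq Q 0 s (f - pval p x)).
Proof.
move=> fQ; elim: N => [|N [p [sp Hp]]].
  exists 0; rewrite size_poly0; split=> //; left.
  by rewrite /pval rmorph0 horner0 subr0 muln0.
case: Hp => [ge|[s [sN sa] os]]; last first.
  exists p; split; first exact: leqW.
  by right; exists s => //; split=> //; apply: leq_trans sN _; rewrite leq_mul2l leqnSn orbT.
have xN : ordeq Q 0 (a * N)%N (x ^+ N) by rewrite PoszM; apply: ordeqX.
have [o|[c o]] := ordge_codim (ordeq_ge xN) ge; first by case: (ordeq_geN xN).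
exists (p + c *: 'X^N); split.
  rewrite (leq_trans (size_polyD _ _)) // geq_max leqW //=.
  by rewrite (leq_trans (size_scale_leq _ _)) // size_polyXn.
have E : f - pval (p + c *: 'X^N) x = f - pval p x - scal c * x ^+ N.
  by rewrite pvalD pvalCX opprD addrA.
(* The orders strictly between [a * N] and [a * N.+1] are [a.-1] in number, and none is divisible by
   [a]. *)
rewrite E; have [o'|[e ea oe]] := ordge_or_eq a.-1 o; [left|right].
  have <- // : (a * N)%N%:Z + 1 + a.-1%:Z = (a * N.+1)%N.
  by rewrite mulnS; move: a_gt0 (a * N)%N => + X; lia.
exists (a * N + e.+1)%N; last first.
  have <- // : (a * N)%N%:Z + 1 + e%:Z = (a * N + e.+1)%N.
  by move: (a * N)%N => X; lia.
have ea' : (e.+1 < a)%N by rewrite -(prednK a_gt0) ltnS.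
split; first by rewrite mulnS addnC ltn_add2r.
by rewrite dvdn_addr ?dvdn_mulr // gtnNdvd.
Qed.

Lemma xXz_unit (e : int) v : v != P -> v != Q -> ordeq v 0 0 (x ^ e).
Proof. by move=> vP vQ; have := ordeqXz e (x_unit vP vQ); rewrite mul0r. Qed.

Section SecondGenerator.
Variables (b n' r : nat) (y : K).
Hypotheses (ab : (a < b)%N) (bE : b = (n' * a + r)%N) (r_gt0 : (0 < r)%N) (ra : (r < a)%N).

Lemma second_generator : polar P b y ->
  (forall (e : nat) z, (0 < e)%N -> (e < n'.+1 * a)%N -> polar Q e z ->
     exists i j : nat, e = (i * a + j * b)%N) ->
  exists2 y', polar P b y' & ordeq Q 0 (a - r)%N y'.
Proof.
move=> [yP yr] gaps; have QP : Q != P by rewrite eq_sym.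
have [p [sp Hp]] := zero_reduction n'.+1 (yr Q QP).
set y' := y - pval p x in Hp.
have xr v : v != P -> ordge v 0 0 x.
  move=> vP; have [->|vQ] := eqVneq v Q; last exact/ordeq_ge/x_unit.
  exact: ordgeW (ordeq_ge xQ).
(* The subtracted polynomial has degree at most [n'], so its pole order at [P] is at most [n' * a],
   less than [b]. *)
have y'P : polar P b y'.
  split; last by move=> v vP; apply: ordgeB; [apply: yr | apply/ordge_pval/xr].
  rewrite /y' -[- pval p x]mulN1r -(rmorphN1 scal); apply: ordeqD => //.
  apply: ordgeZ; apply: ordgeW (ordge_pval_pole (ordeq_ge xP) sp).
  by rewrite bE mulnC; lia.
pose z := y' * x ^ (- n'.+1%:Z).
have zP : ordeq P 0 (a - r)%N z.
  have := ordeqM0 y'P.1 (ordeqXz (- n'.+1%:Z) xP); congr (ordeq _ _ _ _).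
  by rewrite mulrNN bE -PoszM -subzn ?(ltnW ra) // mulnS mulnC; lia.
have zQ (m : int) : ordge Q 0 m y' -> ordge Q 0 (m - (n'.+1 * a)%N%:Z) z.
  move=> o; have := ordgeM0 o (ordeq_ge (ordeqXz (- n'.+1%:Z) xQ)).
  by rewrite mulrN -PoszM mulnC.
have zr v : v != Q -> ordge v 0 0 z.
  move=> vQ; have [->|vP] := eqVneq v P; first by apply: ordgeW (ordeq_ge zP).
  have := ordgeM0 (y'P.2 v vP) (ordeq_ge (xXz_unit (- n'.+1%:Z) vP vQ)).
  by rewrite addr0.
(* In the first case [z] would be regular everywhere and, as [r < a], vanish at [P]; but it is not
   zero. *)
case: Hp => [ge|[s [sN sa] os]].
  have z0 : z = 0.
    apply: (@regular_root P).
      move=> v; have [->|/zr//] := eqVneq v Q.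
      by have := zQ _ ge; rewrite mulnC subrr.
    by apply: ordgeW (ordeq_ge zP); rewrite lez_nat subn_gt0.
  by have := ordeq_neq0 zP; rewrite z0 eqxx.
have s_gt0 : (0 < s)%N by case: s sa {sN os} => //; rewrite dvdn0.
have [|||i [j E]] := gaps (n'.+1 * a - s)%N z.
- by rewrite subn_gt0 mulnC.
- by rewrite ltn_subrL s_gt0 muln_gt0 /=.
- split=> //; have := ordeqM0 os (ordeqXz (- n'.+1%:Z) xQ).
  congr (ordeq _ _ _ _); rewrite mulrN -PoszM mulnC -subzn 1?ltnW // ?(mulnC _ a) //.
  by rewrite opprB.
exists y' => //; move: os; congr (ordeq _ _ _ _); congr Posz.
have sN' : (s < n'.+1 * a)%N by rewrite mulnC.
have sE : ((i * a + j * b) + s = n'.+1 * a)%N by rewrite -E subnK // ltnW.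
(* No copy of [b] would make [a] divide [s], and two copies exceed [n'.+1 * a]. With exactly one,
   [i] must be 0 and [s] is [a - r]. *)
case: j {E} sE => [|[|j]] sE.
- case/negP: sa; have : (a %| i * a + s)%N.
    by move: sE; rewrite mul0n addn0 => ->; apply: dvdn_mull.
  by rewrite dvdn_addr // dvdn_mull.
- case: i sE => [|i]; first by rewrite mul0n mul1n mulSn bE; lia.
  by rewrite !mulSn bE; lia.
by move: sE; rewrite !mulSn; move: (i * a)%N (j * b)%N => X Y; lia.
Qed.

(** The ceiling of [r * j / a]. The product [x ^ i * y' ^+ j] has poles of order at most [a * N] at
    [P] and [Q] exactly when [- N - j + ceil j <= i <= N - n' * j - ceil j]. *)
Let ceil (j : nat) := ((r * j + a.-1) %/ a)%N.

Lemma ceil_ge (j : nat) : (r * j <= a * ceil j)%N.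
Proof.
have := divn_eq (r * j + a.-1) a; have := ltn_pmod (r * j + a.-1) a_gt0.
by rewrite -/(ceil j) mulnC; move: a_gt0; lia.
Qed.

Lemma ceil_le (j : nat) : (ceil j <= j)%N.
Proof.
rewrite /ceil -ltnS ltn_divLR //.
have : (r * j <= a * j)%N by rewrite leq_mul2r ltnW ?orbT.
by rewrite mulSn mulnC; move: a_gt0; lia.
Qed.

(** Because [a] is prime, [r * j / a] and [r * (a - j) / a] are not integers; they sum to [r], and
    rounding both up adds one in total. *)
Lemma ceil_pair (j : nat) : (0 < j)%N -> (j < a)%N -> (ceil j + ceil (a - j) = r.+1)%N.
Proof.
move=> j0 ja; have := divn_eq (r * j) a; have := ltn_pmod (r * j) a_gt0.
have : (0 < (r * j) %% a)%N.
  rewrite lt0n -/(_ %| _)%N; apply/negP; rewrite -/(dvdn _ _) Euclid_dvdM //.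
  by rewrite !gtnNdvd.
move: (_ %% _)%N (_ %/ _)%N => u q u0 ua E.
have qr : (q < r)%N.
  rewrite -(ltn_pmul2r a_gt0); apply: leq_ltn_trans (_ : r * j < _)%N.
    by rewrite E leq_addr.
  by rewrite ltn_pmul2l.
rewrite /ceil; have -> : (r * j + a.-1 = q.+1 * a + u.-1)%N by rewrite E mulSn; lia.
have -> : (r * (a - j) + a.-1 = (r - q) * a + (a - u.+1))%N.
  rewrite mulnBr E mulnBl; have : (q * a + u <= r * a)%N.
    by rewrite -E leq_mul2l ltnW ?orbT.
  move: (q * a)%N (r * a)%N => X Y; lia.
rewrite !divnMDl // !divn_small; lia.
Qed.

Lemma sum_ceil : (2 * \sum_(j < a) ceil j = a.-1 * r.+1)%N.
Proof.
have c0 : ceil 0 = 0%N by apply/eqP; rewrite -leqn0 ceil_le.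
have -> : (\sum_(j < a) ceil j = \sum_(j < a.-1) ceil j.+1)%N.
  have H m : (\sum_(j < m.+1) ceil j = \sum_(j < m) ceil j.+1)%N.
    by rewrite big_ord_recl c0 add0n.
  by rewrite -H prednK.
rewrite mul2n -addnn {2}(reindex_inj rev_ord_inj) -big_split /=.
rewrite -[X in (X * _)%N]card_ord -sum_nat_const; apply: eq_bigr => j _.
have jp := ltn_ord j.
have -> : (a.-1 - j.+1).+1 = (a - j.+1)%N by move: a_gt0; lia.
by apply: ceil_pair => //; move: a_gt0; lia.
Qed.

Lemma genus_le_equal_pencils y' : polar P b y' -> ordeq Q 0 (a - r)%N y' ->
  (2 * genus <= a.-1 * (b - a + r))%N.
Proof.
move=> [yP yr] yQ; have [l0 RR] := Riemann_inequality.
(* Large enough that no subtraction in [len] is truncated and that at least [l0] monomials arise. *)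
pose N := (l0 + n'.+2 * a)%N.
pose D := nseq (a * N) P ++ nseq (a * N) Q.
(* The number of exponents of [x] allowed beside [y' ^+ j]. *)
pose len (j : 'I_a) := (N.*2.+1 + j - (n' * j + (ceil j).*2))%N.
have lenE (j : 'I_a) : (len j + (n' * j + (ceil j).*2) = N.*2.+1 + j)%N.
  rewrite subnK //; have := ceil_le j; have ja := ltn_ord j.
  have : (n' * j <= n' * a)%N by rewrite leq_mul2l ltnW ?orbT.
  by rewrite /N !mulSn; lia.
have sum_len : (2 * \sum_j len j + n' * (a * a.-1) + 2 * (a.-1 * r.+1) =
    2 * (a * N.*2.+1) + a * a.-1)%N.
  have sumj : (2 * \sum_(j < a) j = a * a.-1)%N.
    elim: (a) => [|m IHm]; first by rewrite big_ord0.
    by rewrite big_ord_recr /= mulnDr IHm; case: m {IHm} => //= m; lia.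
  have : (\sum_j (len j + (n' * j + (ceil j).*2)) = \sum_(j < a) (N.*2.+1 + j))%N.
    by apply: eq_bigr => j _; apply: lenE.
  rewrite !big_split /= sum_nat_const card_ord -big_distrr /=.
  have -> : (\sum_(j < a) (ceil j).*2 = a.-1 * r.+1)%N.
    by rewrite -sum_ceil big_distrr; apply: eq_bigr => j _; rewrite /= mul2n.
  by move: sumj; move: (\sum_(i < a) i)%N (\sum_i len i)%N => S1 S2; nia.
have l0S : (l0 <= \sum_j len j)%N.
  rewrite (bigD1 (Ordinal a_gt0)) //= (leq_trans _ (leq_addr _ _)) //.
  by have := lenE (Ordinal a_gt0); have := ceil_le 0; rewrite /N /=; lia.
(* Against the degree [2 * a * N] of [D] the terms in [N] cancel, and twice the genus is at most
   [(a - 1) * (n' * a + 2 * r - a)]. *)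
suff /(RR D _ l0S) : dim_ge scal (Riemann_Roch_space D) (\sum_j len j).
  have n'_gt0 : (0 < n')%N by case: (n') bE ab => // ->; rewrite mul0n; lia.
  rewrite size_cat !size_nseq; move: sum_len; rewrite bE -addnBAC; last first.
    by rewrite -{1}[a]mul1n leq_mul2r n'_gt0 orbT.
  move: (\sum_j len j)%N (N) => L M.
  move: (a) (prime_gt0 a_prime) (n') n'_gt0 => [|a1] // _ [|n1] // _.
  rewrite /= !mulSn addKn; nia.
have -> : (\sum_j len j = #|{: {j : 'I_a & 'I_(len j)}}|)%N.
  by rewrite card_tagged sumnE big_map big_enum; apply: eq_bigr => j _; rewrite card_ord.
(* [tagged t'] counts exponents of [x] from the least admissible one, which is negative in
   general. *)
pose ex (t' : {j : 'I_a & 'I_(len j)}) : int :=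
  (nat_of_ord (tagged t'))%:Z - N%:Z - (tag t')%:Z + (ceil (tag t'))%:Z.
pose F t' := x ^ ex t' * y' ^+ tag t'.
have FP t' : ordeq P 0 (- a%:Z * ex t' - b%:Z * (tag t')%:Z) (F t').
  have := ordeqM0 (ordeqXz (ex t') xP) (ordeqX (tag t') yP).
  by rewrite [- b%:Z * _]mulNr.
have FQ t' : ordeq Q 0 (a%:Z * ex t' + (a - r)%N%:Z * (tag t')%:Z) (F t').
  exact: ordeqM0 (ordeqXz (ex t') xQ) (ordeqX (tag t') yQ).
apply: (dim_ge_fin (e := F)).
  move=> t' v; rewrite mult_cat !mult_nseq.
  have cg := ceil_ge (tag t').
  have le : (tagged t' + n' * tag t' + (ceil (tag t')).*2 <= N.*2 + tag t')%N.
    have := lenE (tag t'); have := ltn_ord (tagged t').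
    move: (nat_of_ord (tagged t')) => i.
    by move: (len (tag t')) (ceil (tag t')) (nat_of_ord (tag t')) (N) => l c j M; lia.
  have [exP exQ] : ex t' + n'%:Z * (tag t')%:Z + (ceil (tag t'))%:Z <= N%:Z /\
      - N%:Z - (tag t')%:Z + (ceil (tag t'))%:Z <= ex t'.
    move: le; rewrite /ex; move: (nat_of_ord (tagged t')) => i.
    by move: (ceil (tag t')) (nat_of_ord (tag t')) (N) => cj j M; split; lia.
  have a0 : 0 <= a%:Z by [].
  have [vP|vP] := eqVneq P v; first (rewrite -vP [Q == P]eq_sym (negPf PQ)).
    apply: ordgeW (ordeq_ge (FP t')); have := ler_wpM2l a0 exP.
    by rewrite bE; move: (ex t') (ceil (tag t')) (nat_of_ord (tag t')) (N) cg => e cj j M; nia.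
  have [vQ|vQ] := eqVneq Q v; first rewrite -vQ.
    apply: ordgeW (ordeq_ge (FQ t')); have := ler_wpM2l a0 exQ.
    rewrite -subzn ?(ltnW ra) //.
    by move: (ex t') (ceil (tag t')) (nat_of_ord (tag t')) (N) cg => e cj j M; nia.
  rewrite !mul0r addr0 oppr0.
  have := ordgeM0 (ordeq_ge (xXz_unit (ex t') _ _)) (regular_powers (tag t') (yr v _)).
  by rewrite addr0; apply; rewrite eq_sym.
move=> c c0 t0; apply/eqP; rewrite -[_ == 0]negbK.
pose o t' := - a%:Z * ex t' - b%:Z * (tag t')%:Z.
apply: (@distinct_orders P 0 _ (fun t' => c t' != 0) (fun t' => scal (c t') * F t') o).
- by move=> t' ct; rewrite -[o t']add0r; apply: ordeqM0; [apply: ordeq_scal | apply: FP].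
(* Equal orders at [P] give [j1] and [j2] congruent modulo [a], since the prime [a] does not divide
   [b]; hence [j1 = j2], and then the exponents of [x] agree. *)
- move=> [j1 i1] [j2 i2] _ _; rewrite /o /ex /=.
  set e1 : int := _ - _ - _ + _; set e2 : int := _ - _ - _ + _ => oE.
  have bE' : b%:Z * (j1%:Z - j2%:Z) = a%:Z * (e2 - e1).
    by move: e1 e2 oE => e1 e2; rewrite !mulrBr; lia.
  have : (a %| b * `|j1%:Z - j2%:Z|)%N.
    by have := congr1 absz bE'; rewrite !abszM /= => ->; apply: dvdn_mulr.
  rewrite Euclid_dvdM // {1}bE dvdn_addr ?dvdn_mull // gtnNdvd //=.
  have j12 : (`|j1%:Z - j2%:Z| < a)%N by have := ltn_ord j1; have := ltn_ord j2; lia.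
  move=> /dvdn_leq jj; have d0 : `|j1%:Z - j2%:Z|%N = 0%N.
    by apply/eqP; rewrite -leqn0 leqNgt; apply/negP => /jj; rewrite leqNgt j12.
  have jE : j1 = j2.
    by apply/val_inj; move/eqP: d0; rewrite absz_eq0 subr_eq0 => /eqP[].
  case: _ / jE i2 @e2 oE {bE' j12} => i2; rewrite /= => oE.
  congr (Tagged _ _); apply/val_inj => /=.
  have : a%:Z * e1 = a%:Z * ((nat_of_ord i2)%:Z - N%:Z - j1%:Z + (ceil j1)%:Z).
    by move: oE; rewrite !mulNr; lia.
  by move/(mulfI (_ : a%:Z != 0)); rewrite /e1; move: a_gt0; lia.
rewrite -[RHS]c0 [RHS](bigID (fun t' => c t' != 0)) /= [X in _ = _ + X]big1 ?addr0 //.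
by move=> t' /negbNE/eqP ->; rewrite rmorph0 mul0r.
Qed.

End SecondGenerator.

End EqualPencils.


Lemma genus_le_two_points (b n' r : nat) x0 u y : (3 * a < b)%N ->
  b = (n' * a + r)%N -> (0 < r)%N -> (r < a)%N ->
  polar P a x0 -> polar Q a u -> polar P b y ->
  (forall (e : nat) z, (0 < e)%N -> (e < n'.+1 * a)%N -> polar Q e z ->
     exists i j : nat, e = (i * a + j * b)%N) ->
  (2 * genus <= (a - 1) * (b - a + r))%N.
Proof.
move=> ab bE r0 ra px pu py gaps.
case: (pencils_independent_or_equal px pu) => [g_le|[x [xP xQ xu]]].
  (* Here [3 * a < b] enters: it puts twice Castelnuovo's bound below [(a - 1) * (b - a + r)]. *)
  have : (2 * a <= b - a + r)%N by move: ab; lia.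
  move=> c_ge; apply: leq_trans (_ : (a - 1) * (2 * a) <= _)%N.
    by move: g_le; case: (a) a_gt0 => [|a1] // _; rewrite !subSS !subn0; nia.
  by rewrite leq_mul2l c_ge orbT.
rewrite subn1; have ab' : (a < b)%N by apply: leq_ltn_trans ab; rewrite leq_pmull.
have [y' py' yQ] := second_generator xP xQ xu ab' bE r0 ra py gaps.
exact: (genus_le_equal_pencils xP xQ xu ab' bE r0 ra py' yQ).
Qed.

End TwoPoints.

End Curve.

(** * Smooth projective curves *)

(** With the convention that the inverse of 0 is 0, [s = 0] would give [f = 0]. This covers
    [has_order], whose uniformizer is not assumed nonzero. *)
Lemma mulr_pole (L : fieldType) (f u s : L) (e : nat) : (0 < e)%N -> f != 0 ->
  f = u * s ^ (- e%:Z) -> s != 0 /\ u = f * s ^+ e.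
Proof.
move=> e0 f0 fE; have s0 : s != 0.
  apply: contraNneq f0 => s0.
  by rewrite fE s0 -exprnN expr0n eqn0Ngt e0 invr0 mulr0.
by rewrite fE -exprnN -mulrA mulVf ?mulr1 // expf_neq0.
Qed.

Section FunctionField.
Variables (S : comNzRingType) (I : prime_idealr S).

Definition to_frac (F : S) : {fraction (quot_domain I)} := tofrac (quot_proj I F).

Fact to_frac_is_zmod_morphism : zmod_morphism to_frac.
Proof.
move=> F G; rewrite /to_frac -tofracB; congr tofrac.
exact: (rmorphB (\pi_({ideal_quot I}))).
Qed.

Fact to_frac_is_monoid_morphism : monoid_morphism to_frac.
Proof.
split=> [|F G]; rewrite /to_frac.
  by rewrite -tofrac1; congr tofrac; exact: (rmorph1 (\pi_({ideal_quot I}))).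
rewrite -tofracM; congr tofrac; exact: (rmorphM (\pi_({ideal_quot I}))).
Qed.

HB.instance Definition _ := GRing.isZmodMorphism.Build S {fraction (quot_domain I)}
  to_frac to_frac_is_zmod_morphism.
HB.instance Definition _ := GRing.isMonoidMorphism.Build S {fraction (quot_domain I)}
  to_frac to_frac_is_monoid_morphism.

Lemma to_frac_eq0 F : (to_frac F == 0) = (F \in I).
Proof.
rewrite /to_frac tofrac_eq0.
have -> : 0 = quot_proj I 0.
  by rewrite /quot_proj; exact/esym/(rmorph0 (\pi_({ideal_quot I}))).
by rewrite -[F in RHS]subr0 (Quotient.idealrBE I).
Qed.

End FunctionField.

Section Curves.
Variables (k : closedFieldType) (n : nat) (X : smooth_curve k n).
Local Notation I := (curve_ideal X).
Local Notation K := (ratio_field I).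

Definition iota_curve : {rmorphism {mpoly k[n.+1]} -> K} := @to_frac _ I.

Lemma iota_curve_eq0 F : iota_curve F = 0 <-> F \in I.
Proof. by rewrite -to_frac_eq0; split=> /eqP. Qed.

Lemma frac_ofE F G : frac_of I F G = iota_curve F / iota_curve G.
Proof. by []. Qed.

Definition coords (p : Defs.point X) (i : 'I_n.+1) : k := point_coord p 0 i.

Lemma pivot_exists (p : Defs.point X) : exists i : 'I_n.+1, coords p i = 1 /\
  forall j : 'I_n.+1, (j < i)%N -> coords p j = 0.
Proof.
have /andP[/existsP[i /andP[/eqP vi /forallP vj]] _] := point_on_curve p.
by exists i; split=> // j ji; apply/eqP; move/implyP: (vj j); apply.
Qed.

Definition pivot (p : Defs.point X) : 'I_n.+1 := projT1 (cid (pivot_exists p)).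

Lemma pivotP p : coords p (pivot p) = 1 /\
  forall j : 'I_n.+1, (j < pivot p)%N -> coords p j = 0.
Proof. exact: projT2 (cid (pivot_exists p)). Qed.

Lemma coords_piv p : coords p (pivot p) = 1.
Proof. by case: (pivotP p). Qed.

Lemma coords_inj p q : coords p =1 coords q -> p = q.
Proof. by move=> E; apply/val_inj/rowP => i; apply: E. Qed.

Lemma iota_curve_homog F d : iota_curve F = 0 -> iota_curve (pihomog mdeg d F) = 0.
Proof. by move/iota_curve_eq0 => FI; apply/iota_curve_eq0/curve_homogeneous. Qed.

Lemma coords_on p F : iota_curve F = 0 -> F.@[coords p] = 0.
Proof.
move/iota_curve_eq0 => FI; have /andP[_ /asboolP] := point_on_curve p.
by apply.
Qed.

(** The candidates are the forms expressing proportionality to [q]. If all of them vanish at [p],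
    the coordinate vectors are proportional, and normalization makes them equal. *)
Lemma coords_sep p q : p != q ->
  exists2 F : {mpoly k[n.+1]}, F \is 1.-homog & F.@[coords p] != 0 /\ F.@[coords q] = 0.
Proof.
move=> pq; apply: contrapT => nF.
have H i j : coords q i * coords p j = coords q j * coords p i.
  apply/eqP; rewrite -subr_eq0; apply/negPn/negP => ne0; apply: nF.
  exists (coords q i *: 'X_j - coords q j *: 'X_i).
    by apply: rpredB; apply: dhomogZ; apply: var_homog.
  by rewrite !mevalB !mevalZ !mevalXU; split=> //; ring.
have [qi q0] := pivotP q; have [pi p0] := pivotP p.
move/eqP: pq; apply; apply: coords_inj => j.
have E l : coords p l = coords q l * coords p (pivot q).
  by rewrite -H qi mul1r.
suff pq1 : coords p (pivot q) = 1 by rewrite E pq1 mulr1.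
have [lt|lt|/val_inj <-//] := ltngtP (pivot p) (pivot q).
  by move: pi; rewrite E q0 // mul0r => /eqP; rewrite eq_sym oner_eq0.
have := E (pivot p); rewrite pi (p0 _ lt) mulr0 => /eqP.
by rewrite oner_eq0.
Qed.

(** Dividing by the first nonzero entry normalizes [u]; rescaling preserves zeros of forms, and the
    ideal is homogeneous. *)
Lemma coords_complete (u : 'I_n.+1 -> k) : (exists a, u a != 0) ->
  (forall F, iota_curve F = 0 -> F.@[u] = 0) ->
  exists p (c : k), forall a, u a = c * coords p a.
Proof.
move=> [a0 ua0] uI.
case: (@arg_minnP _ a0 (fun i => u i != 0) (fun i => nat_of_ord i) ua0) => i ui imin.
pose v : 'rV[k]_n.+1 := \row_j ((u i)^-1 * u j).
have uv j : u j = u i * v 0 j by rewrite mxE mulVKf.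
have nv : normalized v.
  apply/existsP; exists i; rewrite mxE mulVf // eqxx /=; apply/forallP => j.
  apply/implyP => ji; rewrite mxE mulf_eq0 orbC -[u j == 0]negbK.
  by apply/orP; left; apply/negP => /imin; rewrite leqNgt ji.
have ov : on_variety I v.
  rewrite /on_variety nv; apply/asboolP => F FI; rewrite /eval_at.
  have /pihomog_partitionE -> := leqnn (mmeasure mdeg F).
  rewrite raddf_sum big1 // => d _.
  have := uI _ (iota_curve_homog d (iffRL (iota_curve_eq0 F) FI)).
  rewrite (meval_homog (pihomogP mdeg d F) uv) => /eqP.
  by rewrite mulf_eq0 expf_eq0 (negPf ui) andbF => /eqP.
by exists (Point ov), (u i).
Qed.

Local Notation ev := (@ev k n K iota_curve (Defs.point X) coords).

Lemma local_ringP (p : Defs.point X) f : local_ring p f <-> exists c, ev p f c.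
Proof.
split=> [[d [F [G [hF hG G0 ->]]]]|[c [d [F [G [hF hG G0 -> _]]]]]].
  by exists (F.@[coords p] / G.@[coords p]), d, F, G.
by exists d, F, G.
Qed.

Lemma local_maximal_idealP (p : Defs.point X) f : local_maximal_ideal p f <-> ev p f 0.
Proof.
split=> [[d [F [G [hF hG G0 F0 ->]]]]|[d [F [G [hF hG G0 -> /esym/eqP]]]]].
  exists d, F, G; split=> //; rewrite [F.@[_]]F0.
  by rewrite mul0r.
rewrite mulf_eq0 invr_eq0 (negPf G0) orbF => /eqP F0.
by exists d, F, G.
Qed.

Lemma hilbert_value_dim m h : hilbert_value I m h ->
  dim_ge (scal iota_curve) (section_space iota_curve m) h /\
  ~ dim_ge (scal iota_curve) (section_space iota_curve m) h.+1.
Proof.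
move=> [e [he fe ge]].
have E c : lin_comb (scal iota_curve) c (fun i => iota_curve (e i)) =
    iota_curve (\sum_i c i *: e i).
  rewrite rmorph_sum; apply: eq_bigr => i _.
  by rewrite -mul_mpolyC rmorphM.
split.
  exists (fun i => iota_curve (e i)) => [i|c]; first by exists (e i).
  by rewrite E => /iota_curve_eq0; apply: fe.
apply: codim_le_dimP; exists (fun i => iota_curve (e i)) => f [F hF ->].
have [c cI] := ge F hF; exists c.
by rewrite E -rmorphB; apply/iota_curve_eq0.
Qed.

Lemma has_genus_dim g : has_genus X g -> exists d m0 : nat, forall m h : nat, (m0 <= m)%N ->
  dim_ge (scal iota_curve) (section_space iota_curve m) h <-> (h + g <= d * m + 1)%N.
Proof.
move=> [d [m0 H]]; exists d, m0 => m h mm.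
have [h0 /hilbert_value_dim[d0 nd0] <-] := H m mm; rewrite leq_add2r.
split=> [dh|hh]; last exact: dim_ge_leq hh d0.
by rewrite leqNgt; apply/negP => hh; apply: nd0; apply: dim_ge_leq hh dh.
Qed.

Lemma uniformizerP (p : Defs.point X) s : uniformizer p s ->
  ev p s 0 /\ forall f, ev p f 0 -> exists h c, ev p h c /\ f = h * s.
Proof.
move=> [/local_maximal_idealP s0 sG]; split=> // f /local_maximal_idealP /sG[h].
by move=> /local_ringP[c hc] ->; exists h, c.
Qed.

Lemma local_maximal_idealE (p : Defs.point X) f : local_ring p f ->
  ~ local_maximal_ideal p f -> exists2 c, ev p f c & c != 0.
Proof.
move=> /local_ringP[c fc] nf; exists c => //; apply/eqP => c0; apply: nf.
by apply/local_maximal_idealP; rewrite -c0.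
Qed.

(* A vanishing uniformizer at [q] would force every rational function to be
   constant. *)
Lemma uniformizer_neq0 (p q : Defs.point X) f (e : nat) s : (0 < e)%N ->
  function_field f -> f != 0 -> has_order p f (- e%:Z) -> uniformizer q s -> s != 0.
Proof.
move=> e0 [d [F [G [hF hG GI fE]]]] f0 [t' [u [/uniformizerP[t0 _] uO um fE']]].
move=> /uniformizerP[_ sG]; apply/eqP => s0.
(* If [s = 0] generates the maximal ideal at [q], every form of degree [d] vanishing at [q] is zero
   on the curve. *)
have max0 A B : A \is d.-homog -> B \is d.-homog -> B.@[coords q] != 0 ->
    A.@[coords q] = 0 -> iota_curve A = 0.
  move=> hA hB B0 A0; have : ev q (iota_curve A / iota_curve B) 0.
    by exists d, A, B; split=> //; rewrite A0 mul0r.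
  move/sG => [h [c [_]]]; rewrite s0 mulr0 => /eqP.
  rewrite mulf_eq0 invr_eq0 => /orP[/eqP//|/eqP/(coords_on q) E].
  by rewrite E eqxx in B0.
have G0 : iota_curve G != 0 by apply/eqP => /iota_curve_eq0; apply/negP.
have Gq : G.@[coords q] != 0.
  apply/eqP => Gq; move/eqP: G0; apply.
  apply: (max0 G ('X_(pivot q) ^+ d)) => //; first exact: piv_form_homog.
  by rewrite piv_form_eval ?oner_eq0 //; apply: coords_piv.
pose c := F.@[coords q] / G.@[coords q].
have fc : f = scal iota_curve c.
  have : iota_curve (F - c *: G) = 0.
    apply: (max0 _ G) => //; last by rewrite mevalB mevalZ divfK ?subrr.
    by apply: rpredB => //; apply: dhomogZ.
  rewrite rmorphB => /eqP; rewrite subr_eq0 => /eqP FE.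
  by rewrite fE frac_ofE FE -mul_mpolyC rmorphM mulfK.
(* A constant has no pole: the unit [u], being [c * t' ^+ e] with [e > 0], would vanish at [p]. *)
have [b ub b0] := local_maximal_idealE uO um.
have [t'_neq0 uE] := mulr_pole e0 f0 fE'; rewrite fc in uE.
have [b' tb'] : exists b', ev p (t' ^+ e.-1) b'.
  elim: (e.-1) => [|m [b' IHm]]; first by exists 1; rewrite expr0; apply: ev1.
  by exists (0 * b'); rewrite exprS; apply: evM.
have : ev p u (c * (0 * b')).
  by rewrite uE -(prednK e0) exprS; apply: evM; [apply: ev_scal | apply: evM].
rewrite mul0r mulr0 => u0; move/eqP: b0; apply; apply: (ev_uniq _ ub u0).
exact: coords_on.
Qed.

(** * Orders and linear systems in terms of chosen uniformizers *)

Section Points.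
Variable t : Defs.point X -> K.
Hypothesis t_neq0 : forall p, t p != 0.
Hypothesis t_unif : forall p, uniformizer p (t p).
Variables (deg g m0 : nat).
Hypothesis hilb : forall m h : nat, (m0 <= m)%N ->
  dim_ge (scal iota_curve) (section_space iota_curve m) h <-> (h + g <= deg * m + 1)%N.

Let t_max p : ev p (t p) 0. Proof. by have [] := uniformizerP (t_unif p). Qed.
Let t_gen p f : ev p f 0 -> exists h c, ev p h c /\ f = h * t p.
Proof. by have [_] := uniformizerP (t_unif p); apply. Qed.

Local Notation ordeq := (ordeq iota_curve coords pivot t).
Local Notation polar := (polar iota_curve coords pivot t).

(** The uniformizer [s] in [has_order] need not be [t p], but each is a multiple of the other in the
    local ring, so they differ by a unit. *)
Lemma has_order_ordeq (p : Defs.point X) f (m : int) : has_order p f m -> ordeq p 0 m f.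
Proof.
move=> [s [u [us uO um ->]]]; have [s0 sG] := uniformizerP us.
have [c uc c0] := local_maximal_idealE uO um.
have ou : ordeq p 0 0 u by exists u, c; split=> //; rewrite !expr0z !mulr1.
have [h [b [hb sE]]] := t_gen s0; have [h' [b' [hb' tE]]] := sG _ (t_max p).
have b_neq0 : b != 0.
  apply/eqP => b0; have : ev p (h' * h) 0 by have := evM hb' hb; rewrite b0 mulr0.
  have -> : h' * h = 1.
    by apply: (mulIf (t_neq0 p)); rewrite mul1r -mulrA -sE -tE.
  move=> /(ev_uniq (@coords_on) (ev1 _ _ p))/eqP.
  by rewrite oner_eq0.
have os : ordeq p 0 1 s.
  by exists h, b; split=> //; rewrite expr0z mulr1 expr1z.
have := ordeqM0 (@coords_on) coords_piv t_neq0 ou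
  (ordeqXz (@coords_on) coords_piv t_neq0 m os).
by rewrite add0r mul1r.
Qed.

Lemma ordeq_has_order (p : Defs.point X) f (m : int) : ordeq p 0 m f -> has_order p f m.
Proof.
move=> [h [c [hc c0 ->]]]; exists (t p), h; split=> //.
- by apply/local_ringP; exists c.
- move=> /local_maximal_idealP h0; move/eqP: c0; apply.
  exact: ev_uniq (@coords_on) _ _ _ _ hc h0.
- by rewrite expr0z mulr1.
Qed.

(** A member of the linear system avoiding [p] is [e] times [p] plus a principal divisor, whose
    function then has a pole of exact order [e] at [p] and no other. *)
Lemma WS_polar (p : Defs.point X) (e : nat) : (0 < e)%N -> WS p e -> exists x, polar p e x.
Proof.
move=> e0 [/= e00|/(_ p)[D [De [f [_ _ fD]]] Dp]]; first by rewrite e00 in e0.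
have cD q : coeff q (D - << e%:Z *g p >>) = coeff q D - e%:Z * (p == q)%:R.
  by rewrite coeffB coeffU.
exists f; split=> [|q qp].
  by have := has_order_ordeq (fD p); rewrite cD Dp eqxx mulr1 sub0r.
have := has_order_ordeq (fD q); rewrite cD eq_sym (negPf qp) mulr0 subr0 => oq.
apply: (ordgeW t_neq0 t_max _ (ordeq_ge oq)).
exact: De.
Qed.

Lemma polar_divisor (p : Defs.point X) (e : nat) z : polar p e z ->
  exists D, [/\ complete_linear_system << e%:Z *g p >> D
    & forall q (m : int), ordeq q 0 m z -> coeff q D = m + e%:Z * (p == q)%:R].
Proof.
move=> [zp zr].
have z0 := ordeq_neq0 (@coords_on) coords_piv t_neq0 zp.
have rz := ordge_ratio (@coords_on) t_neq0 t_max (ordeq_ge zp).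
have [D1 [D2 [_ zD]]] := function_divisor iota_curve_homog (@coords_on) coords_piv
  coords_sep coords_complete t_neq0 t_max t_gen p hilb z0 rz.
pose fdiv (s : seq (Defs.point X)) : divisor X := \sum_(q <- s) << q >>.
have fdivE s q : coeff q (fdiv s) = mult q s.
  rewrite /fdiv raddf_sum /mult; elim: s => [|a s IHs]; first by rewrite big_nil.
  by rewrite big_cons IHs /= coeffU mul1r PoszD natz.
pose D := fdiv D1 - fdiv D2 + << e%:Z *g p >>.
have DE q (m : int) : ordeq q 0 m z -> coeff q D = m + e%:Z * (p == q)%:R.
  move=> zm; rewrite coeffD coeffB !fdivE coeffU; congr (_ + _).
  exact: (ordeq_uniq (@coords_on) coords_piv t_neq0 t_max (zD q) zm).
exists D; split=> //; split.
  move=> q; have := DE q _ (zD q); have [->|qp] := eqVneq q p.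
    by rewrite (DE p _ zp) eqxx mulr1 addNr => _.
  rewrite mulr0 addr0 => ->.
  exact: (ordeq_ge_le (@coords_on) coords_piv t_neq0 t_max (zD q) (zr q qp)).
exists z; split=> //.
  have [d [F [G [hF hG G0 zE]]]] := rz; exists d, F, G; split=> //.
  by apply/negP => /iota_curve_eq0 E; rewrite E eqxx in G0.
move=> q; rewrite /D addrK coeffB !fdivE; exact: ordeq_has_order.
Qed.

(** At [p] the divisor of [z] plus [e] times [p] has coefficient 0. At another [q], adding a
    constant makes [z] nonzero at [q] without changing its pole. *)
Lemma polar_WS (p : Defs.point X) (e : nat) z : (0 < e)%N -> polar p e z -> WS p e.
Proof.
move=> e0 pz; right => q.
have [->|qp] := eqVneq q p.
  have [D [LD DE]] := polar_divisor pz; exists D => //.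
  by rewrite (DE p _ pz.1) eqxx mulr1 addNr.
have [h [c [hc]]] := pz.2 q qp; rewrite !expr0z !mulr1 => zh.
have [b cb] : exists b : k, c + b != 0.
  have [c0|c0] := eqVneq c 0; last by exists 0; rewrite addr0.
  by exists 1; rewrite c0 add0r oner_eq0.
have pz' : polar p e (z + scal iota_curve b).
  split=> [|w wp].
    apply: (ordeqD (@coords_on) t_neq0 t_max pz.1).
    apply: (ordgeW t_neq0 t_max _ (ordge_scal _ _ _ _ _ _)).
    by lia.
  by apply: (ordgeD (@coords_on)); [apply: pz.2 | apply: ordge_scal].
have [D [LD DE]] := polar_divisor pz'; exists D => //.
have oq : ordeq q 0 0 (z + scal iota_curve b).
  exists (z + scal iota_curve b), (c + b); split=> //; last by rewrite !expr0z !mulr1.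
  by rewrite zh; apply: (evD (@coords_on)) => //; apply: ev_scal.
by rewrite (DE q _ oq) eq_sym (negPf qp) mulr0.
Qed.

End Points.

End Curves.

Lemma semigroup_gen_sub a b m : semigroup_gen a b m ->
  exists i j : nat, m = (i * a + j * b)%N.
Proof.
have := @smallest_sub _ subsemigroup [set a; b]%classic
  [set m | exists i j : nat, m = (i * a + j * b)%N]%classic.
apply; last by move=> x [->|->]; [exists 1%N, 0%N | exists 0%N, 1%N]; lia.
split; first by exists 0%N, 0%N.
move=> _ _ [i [j ->]] [i' [j' ->]]; exists (i + i')%N, (j + j')%N; lia.
Qed.

Local Close Scope quotient_scope.
Local Close Scope ring_scope.

Theorem corollary6 (R : realType) (a b n r g : nat) (H : set nat)
    (a_prime : prime a) (b_gt : 3 * a < b) (b_ndvd : ~~ (a %| b))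
    (b_eq : b = n * a + r) (r_range : 1 <= r <= a - 1)
    (H_semigroup : weierstrass_semigroup g H)
    (H_gen : (semigroup_gen a b `<=` H)%classic)
    (H_small : forall m, H m -> m < n.+1 * a -> semigroup_gen a b m)
    (g_gt : (a - 1) * (b - a + r) < 2 * g) :
  occurs_at_most_once R g H.
Proof.
move=> [N [X [P [Q [hg PQ HP HQ]]]]].
have a0 : 0 < a := prime_gt0 a_prime.
have b0 : 0 < b by apply: leq_ltn_trans b_gt.
have /andP[r0 ra] := r_range.
have ra' : r < a by move: ra a0; lia.
have Ha : H a by apply: H_gen; apply: sub_gen_smallest; left.
have Hb : H b by apply: H_gen; apply: sub_gen_smallest; right.
(* A function with a pole, used to exclude zero uniformizers through [uniformizer_neq0]. *)
have [p [f [e [e0 ff f0 fp]]]] : exists p f (e : nat),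
    [/\ 0 < e, function_field f, f != 0%R & @has_order _ _ X p f (- e%:Z)%R].
  have : WS P a by rewrite HP.
  move=> [/= a00|/(_ P)[D [De [f [ff f0 fD]]] DP]]; first by rewrite a00 in a0.
  exists P, f, a; split=> //; have := fD P.
  by rewrite coeffB coeffU DP eqxx mulr1 sub0r.
(* That a function has a divisor includes an order, and so a uniformizer, at every point. *)
have /choice[t t_unif] (q : Defs.point X) : exists s, uniformizer q s.
  have : WS P a by rewrite HP.
  move=> [/= a00|/(_ P)[D [De [h [_ _ fD]]] DP]]; first by rewrite a00 in a0.
  by have [s [u [us _ _ _]]] := fD q; exists s.
have t_neq0 q : t q != 0%R := uniformizer_neq0 e0 ff f0 fp (t_unif q).
have [d [m0 hilb]] := has_genus_dim hg.
have [x px] : exists x, polar (iota_curve X) (@coords _ _ X) (@pivot _ _ X) t P a x.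
  by apply: WS_polar => //; rewrite HP.
have [u pu] : exists u, polar (iota_curve X) (@coords _ _ X) (@pivot _ _ X) t Q a u.
  by apply: WS_polar => //; rewrite HQ.
have [y py] : exists y, polar (iota_curve X) (@coords _ _ X) (@pivot _ _ X) t P b y.
  by apply: WS_polar => //; rewrite HP.
have PQ' : P != Q by apply/eqP.
move: g_gt; apply/negP; rewrite -leqNgt.
apply: (genus_le_two_points _ _ _ _ _ _ _ _ _ hilb PQ' a_prime b_gt b_eq r0 ra' px pu py).
- exact: iota_curve_homog.
- exact: coords_on.
- exact: coords_piv.
- exact: coords_sep.
- exact: coords_complete.
- exact: t_neq0.
- by move=> q; have [] := uniformizerP (t_unif q).
- by move=> q h; have [_] := uniformizerP (t_unif q); apply.
- exact: P.
(* A pole order at [Q] lies in [WS Q = H], and below [n.+1 * a] the elements of [H] are combinations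
   of [a] and [b]. *)
move=> m z m_gt0 m_lt pz; apply: semigroup_gen_sub; apply: H_small => //.
rewrite -HQ; exact: (polar_WS t_neq0 t_unif hilb m_gt0 pz).
Qed.
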